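(* Let $\mathfrak{g} = T \oplus \sum_{\alpha\in R^+}\mathbb{C}\cdot X_\alpha$ be the Borel subalgebra of a complex semisimple Lie algebra, where $T$ is a Cartan subalgebra, $R$ is the root system, $R^+$ is a system of positive roots and each $X_\alpha$ is a nonzero root vector for $\alpha$. Let $\mathfrak{g}'=[\mathfrak{g},\mathfrak{g}]$. Then the following hold. (1) Every one-dimensional ideal of $\mathfrak{g}$ is of the form $\langle X_h\rangle$ with $h\in R^+$ such that $[X_a,X_h]=0$ for all simple roots $a$. In particular, if $R$ is irreducible, then $\mathfrak{g}$ has a unique one-dimensional ideal, namely $\mathbb{C}\cdot X_h$, where $h$ is the highest root. (2) Let $J\subsetneq\mathfrak{g}'$ be a $d$-dimensional ideal of $\mathfrak{g}$ properly contained in $\mathfrak{g}'$, and let $R_J\subseteq R^+$ be the set of roots of $T$ in $J$. Then every one-dimensional ideal of $\mathfrak{g}/J$ contained in $\mathfrak{g}'/J$ is of the form $\langle\overline{X_\alpha}\rangle$, where $\overline{X_\alpha}$ is the image of $X_\alpha$ in $\mathfrak{g}/J$ and $\alpha\in R^+\setminus R_J$ is such that, for every simple root $a$, either $[X_a,X_\alpha]=0$ or $a+\alpha\in R_J$.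
   Context: $R$ is the root system of the complex semisimple Lie algebra with respect to the Cartan subalgebra $T$. The simple roots are those of the base of $R$ determined by $R^+$. For each $\alpha\in R^+$, $X_\alpha$ is a fixed nonzero vector in the root space of $\alpha$. The derived algebra of the Borel subalgebra is $\mathfrak{g}'=\sum_{\alpha\in R^+}\mathbb{C}\cdot X_\alpha$. For an ideal $J$ of $\mathfrak{g}$, $R_J$ is the set of $\alpha\in R^+$ whose root space is contained in $J$. Angle brackets denote linear span. *)

(* Defs.v *)
From mathcomp Require Import all_boot all_order all_algebra.
From mathcomp Require Import finmap.
From mathcomp Require Import reals complex.

Set Implicit Arguments.
Unset Strict Implicit.
Unset Printing Implicit Defensive.

Import GRing.Theory.
Local Open Scope ring_scope.

Section LieAlgebra.
Variables (K : fieldType) (V : vectType K) (br : V -> V -> V).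
Implicit Types (g I U W : {vspace V}) (x y z : V).

(* A Lie algebra is a subspace g on which br restricts to a Lie bracket; the
   values of br outside g are irrelevant.  An abstract Lie algebra is the case
   g = fullv. *)
Definition lie_algebra g : Prop :=
  [/\ forall x y, x \in g -> y \in g -> br x y \in g,
      forall (c : K) x y z, x \in g -> y \in g -> z \in g ->
        br (c *: x + y) z = c *: br x z + br y z /\
        br z (c *: x + y) = c *: br z x + br z y,
      forall x, x \in g -> br x x = 0 &
      forall x y z, x \in g -> y \in g -> z \in g ->
        br x (br y z) + br y (br z x) + br z (br x y) = 0].

Definition lie_ideal g I : Prop :=
  (I <= g)%VS /\ (forall x y, x \in g -> y \in I -> br x y \in I).

Definition lie_prod U W : {vspace V} :=
  <<[seq br u w | u <- vbasis U, w <- vbasis W]>>%VS.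

Definition derived g : {vspace V} := lie_prod g g.

Definition solvable_lie g : Prop := exists n, iter n derived g = 0%VS.

Definition semisimple : Prop :=
  lie_algebra fullv /\
  (forall I, lie_ideal fullv I -> solvable_lie I -> I = 0%VS).

Definition abelian_sub U : Prop :=
  forall x y, x \in U -> y \in U -> br x y = 0.

Definition ad_diagonalizable x : Prop :=
  exists b : seq V, basis_of fullv b /\
    (forall v, v \in b -> exists c : K, br x v = c *: v).

(* Cartan subalgebra of a complex semisimple Lie algebra: a maximal abelian
   subalgebra consisting of ad-semisimple elements (Helgason, III.3); over an
   algebraically closed field, semisimple endomorphism means diagonalizable. *)
Definition cartan_subalgebra (T : {vspace V}) : Prop :=
  [/\ abelian_sub T,
      forall U, abelian_sub U -> (T <= U)%VS -> U = T &
      forall t, t \in T -> ad_diagonalizable t].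

(* The trace of (ad x) o (ad y). *)
Definition killing x y : K :=
  \sum_(i < \dim {:V})
     coord (vbasis {:V}) i (br x (br y (vbasis {:V})`_i)).

End LieAlgebra.

Section LieProd.
Variables (K : fieldType) (V : vectType K) (br : V -> V -> V).

Lemma lie_prod_min (U W I : {vspace V}) :
  (forall x y, x \in U -> y \in W -> br x y \in I) ->
  (lie_prod br U W <= I)%VS.
Proof.
move=> h; apply/span_subvP => _ /allpairsP[[u w] /= [hu hw ->]].
by apply: h; apply: vbasis_mem.
Qed.

Lemma mem_lie_prod (g U W : {vspace V}) x y :
  lie_algebra br g -> (U <= g)%VS -> (W <= g)%VS ->
  x \in U -> y \in W -> br x y \in lie_prod br U W.
Proof.
case=> _ lin _ _ /subvP sU /subvP sW xU yW.
have linl c a b d : a \in g -> b \in g -> d \in g ->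
  br (c *: a + b) d = c *: br a d + br b d by move=> *; case: (lin c a b d).
have linr c a b d : a \in g -> b \in g -> d \in g ->
  br d (c *: a + b) = c *: br d a + br d b by move=> *; case: (lin c a b d).
have br0r d : d \in g -> br d 0 = 0.
  move=> dg; have := linr (-1) 0 0 d (mem0v _) (mem0v _) dg.
  by rewrite scaler0 addr0 scaleN1r addNr.
have br0l d : d \in g -> br 0 d = 0.
  move=> dg; have := linl (-1) 0 0 d (mem0v _) (mem0v _) dg.
  by rewrite scaler0 addr0 scaleN1r addNr.
have in_r u : u \in vbasis U -> br u y \in lie_prod br U W.
  move=> uB; rewrite (coord_vbasis yW).
  pose P z := (z \in W) && (br u z \in lie_prod br U W).
  suff /andP[] : P (\sum_(i < \dim W) coord (vbasis W) i y *: (vbasis W)`_i) by [].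
  have ug : u \in g by apply/sU/vbasis_mem.
  elim/big_rec: _ => [|i z _ /andP[zW zP]].
    by rewrite /P mem0v br0r // mem0v.
  have bB : (vbasis W)`_i \in vbasis W by rewrite mem_nth // size_tuple.
  have bW := vbasis_mem bB.
  rewrite /P linr ?ug ?sW // ?memvD ?memvZ ?zP //=.
  by apply/memv_span/allpairsP; exists (u, (vbasis W)`_i).
rewrite (coord_vbasis xU).
pose P z := (z \in U) && (br z y \in lie_prod br U W).
suff /andP[] : P (\sum_(i < \dim U) coord (vbasis U) i x *: (vbasis U)`_i) by [].
elim/big_rec: _ => [|i z _ /andP[zU zP]].
  by rewrite /P mem0v br0l ?sW // mem0v.
have bB : (vbasis U)`_i \in vbasis U by rewrite mem_nth // size_tuple.
have bU := vbasis_mem bB.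
rewrite /P linl ?(sU _ bU) ?(sU _ zU) ?(sW _ yW) //.
by apply/andP; split; apply: memvD => //; apply: memvZ => //; apply: in_r.
Qed.

End LieProd.

(* V/J is realized on the chosen complement J^C of J; quo_pi_surj and
   quo_pi_ker say that quo_pi is a surjective linear map with kernel J. *)
Section Quotient.
Variables (K : fieldType) (V : vectType K) (br : V -> V -> V).
Variable J : {vspace V}.

Definition quo : vectType K := subvs_of (J^C)%VS.

Definition quo_pi : 'Hom(V, quo) :=
  (linfun (vsproj (J^C)%VS) \o daddv_pi (J^C)%VS J)%VF.

(* The bracket of two classes is the class of the bracket of representatives;
   it does not depend on them for classes of elements of a Lie algebra in which
   J is an ideal, see quo_brE. *)
Definition quo_br (u v : quo) : quo := quo_pi (br (vsval u) (vsval v)).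

Let capJ : (J^C :&: J = 0)%VS. Proof. by rewrite capvC capv_compl. Qed.

Let addJ w : w \in (J^C + J)%VS.
Proof. by rewrite addvC addv_complf memvf. Qed.

Lemma vsval_quo_pi x : vsval (quo_pi x) = daddv_pi (J^C)%VS J x.
Proof. by rewrite comp_lfunE lfunE /= vsprojK // memv_pi. Qed.

Lemma quo_pi_vsval (u : quo) : quo_pi (vsval u) = u.
Proof. by apply: val_inj; rewrite /= vsval_quo_pi daddv_pi_id // subvsP. Qed.

Lemma quo_pi_surj : limg quo_pi = fullv.
Proof.
apply/eqP; rewrite eqEsubv subvf; apply/subvP => u _.
by rewrite -(quo_pi_vsval u) memv_img // memvf.
Qed.

Lemma quo_pi_repr x : x - vsval (quo_pi x) \in J.
Proof.
rewrite vsval_quo_pi -{1}(daddv_pi_add capJ (addJ x)) addrAC subrr add0r.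
exact: memv_pi.
Qed.

Lemma quo_pi_eq0 x : (quo_pi x == 0) = (x \in J).
Proof.
apply/eqP/idP => [h|xJ]; first by have := quo_pi_repr x; rewrite h [vsval 0]linear0 subr0.
apply: val_inj; rewrite [LHS]vsval_quo_pi [RHS]linear0.
have cap' : (J :&: J^C = 0)%VS by rewrite capv_compl.
have := daddv_pi_add capJ (addJ x).
by rewrite (daddv_pi_id cap' xJ) -[RHS]add0r => /addIr.
Qed.

Lemma quo_pi_ker : lker quo_pi = J.
Proof. by apply/vspaceP => x; rewrite memv_ker quo_pi_eq0. Qed.

Section Ideal.
Variable g : {vspace V}.
Hypotheses (hg : lie_algebra br g) (hJ : lie_ideal br g J).

Lemma quo_brE x y : x \in g -> y \in g ->
  quo_br (quo_pi x) (quo_pi y) = quo_pi (br x y).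
Proof.
case: hg hJ => clo lin alt _ [/subvP sJ idJ] xg yg.
set x' := vsval (quo_pi x); set y' := vsval (quo_pi y).
have xJ : x - x' \in J := quo_pi_repr x.
have yJ : y - y' \in J := quo_pi_repr y.
have x'g : x' \in g by rewrite -[x'](subKr x) memvB // sJ.
have y'g : y' \in g by rewrite -[y'](subKr y) memvB // sJ.
have ac a b : a \in g -> b \in g -> br a b = - br b a.
  move=> ag bg; have abg : a + b \in g by rewrite memvD.
  apply/eqP; rewrite -addr_eq0; apply/eqP.
  have := alt _ abg.
  have [+ _] := lin 1 a b (a + b) ag bg abg; rewrite !scale1r => ->.
  have [_] := lin 1 a b a ag bg ag; rewrite !scale1r => ->.
  have [_] := lin 1 a b b ag bg bg; rewrite !scale1r => ->.
  by rewrite !alt // add0r addr0.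
apply/eqP; rewrite -subr_eq0 -linearB /= quo_pi_eq0.
have -> : br x y = br x' y' + br (x - x') y' + br x (y - y').
  have xsg : x - x' \in g by rewrite memvB.
  have ysg : y - y' \in g by rewrite memvB.
  have [] := lin 1 (x - x') x' y' xsg x'g y'g; rewrite !scale1r subrK => + _.
  have [_] := lin 1 (y - y') y' x ysg y'g xg; rewrite !scale1r subrK => -> ->.
  by rewrite [RHS]addrC [in RHS](addrC (br x' y')).
rewrite -addrA opprD addrA subrr add0r memvN memvD //; last exact: idJ.
by rewrite ac ?memvB // memvN idJ.
Qed.

Lemma quo_lie_algebra : lie_algebra quo_br (quo_pi @: g).
Proof.
have E := quo_brE; case: hg => clo lin alt jac; split.
- by move=> _ _ /memv_imgP[x xg ->] /memv_imgP[y yg ->]; rewrite E ?memv_img ?clo.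
- move=> c _ _ _ /memv_imgP[x xg ->] /memv_imgP[y yg ->] /memv_imgP[z zg ->].
  rewrite -linearP !E ?memvD ?memvZ //.
  by have [-> ->] := lin c x y z xg yg zg; rewrite !linearP.
- by move=> _ /memv_imgP[x xg ->]; rewrite E // alt // linear0.
- move=> _ _ _ /memv_imgP[x xg ->] /memv_imgP[y yg ->] /memv_imgP[z zg ->].
  by rewrite !E ?clo // -!linearD /= jac // linear0.
Qed.

End Ideal.
End Quotient.

Arguments quo_br {K V} br J u v.

Notation dual T := 'Hom(subvs_of T, _^o).

Section Roots.
Variables (K : fieldType) (L : vectType K) (br : L -> L -> L).
Variable T : {vspace L}.

Implicit Types (a b h : dual T) (x : L).

Definition weight_vector a x : Prop :=
  forall t : subvs_of T, br (vsval t) x = (a t : K) *: x.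

Definition is_root a : Prop :=
  a != 0 /\ exists2 x, x != 0 & weight_vector a x.

(* (a, b) = b(t_a), where t_a in T represents a for the Killing form. *)
Definition orthogonal_roots a b : Prop :=
  exists2 s : subvs_of T,
    (forall t : subvs_of T, killing br (vsval s) (vsval t) = a t) & b s = 0.

Definition irreducible_roots : Prop :=
  (exists a, is_root a) /\
  (forall A B : dual T -> Prop,
     (forall a, is_root a <-> A a \/ B a) ->
     (exists a, A a) -> (exists b, B b) ->
     ~ (forall a b, A a -> B b -> orthogonal_roots a b)).

Variable Rp : {fset dual T}.

Definition positive_system : Prop :=
  [/\ forall a, a \in Rp -> is_root a,
      forall a, is_root a -> (a \in Rp) (+) (- a \in Rp) &
      forall a b, a \in Rp -> b \in Rp -> is_root (a + b) -> a + b \in Rp].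

Definition simple_root a : bool :=
  (a \in Rp) && all (fun b => a - b \notin Rp) Rp.

Definition highest_root h : Prop :=
  is_root h /\
  (forall b, is_root b -> exists n : dual T -> nat,
     h - b = \sum_(a <- Rp | simple_root a) a *+ n a).

Definition root_vectors (X : dual T -> L) : Prop :=
  forall a, a \in Rp -> X a != 0 /\ weight_vector a (X a).

Definition borel (X : dual T -> L) : {vspace L} :=
  (T + \sum_(a <- Rp) <[X a]>)%VS.

(* R_J: the positive roots whose whole root space lies in J. *)
Definition roots_in (J : {vspace L}) a : Prop :=
  a \in Rp /\ (forall x, weight_vector a x -> x \in J).

End Roots.

(* Main.v *)
(* On a [T]-stable subspace every weight component of a vector stays inside, so
   a line which is an ideal is spanned by a vector of [T] or by one root vector;
   the former would be central.  The same remark applied to the preimage of the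
   line settles the quotient.  For the highest root, the ideal of the whole Lie
   algebra generated by a line ideal of the Borel subalgebra has only weights
   below that of its generator, and orthogonality of the roots occurring in an
   ideal to the other ones forces it to contain all roots when R is irreducible.

   The root theory needed (one-dimensional root spaces, coroots, integrality)
   is reached from nondegeneracy of the Killing form.  As T is its own
   centralizer, Cartan's criterion reduces to this: the part of the radical of
   the form outside T is an ideal without zero weight, and a graded version of
   Engel's theorem gives such an ideal a nonzero centre. *)
From HB Require Import structures.
Require Import Defs.
From mathcomp Require Import all_boot all_order all_algebra.
From mathcomp Require Import finmap boolp ring.
From mathcomp Require Import reals complex.

Set Implicit Arguments.
Unset Strict Implicit.
Unset Printing Implicit Defensive.

Import Order.TTheory GRing.Theory Num.Theory.
Local Open Scope ring_scope.

(** * Maximal subspaces, eigencomponents and traces *)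

Section LinearAlgebra.
Variables (K : fieldType) (V : vectType K).
Implicit Types (U W : {vspace V}).

(** Induction on the codimension of [U0]: either a strictly larger subspace satisfies [Q], or [U0]
    is maximal. Subspaces defined by closure conditions are obtained from this. *)
Lemma vspace_maximal (Q : {vspace V} -> Prop) U0 : Q U0 ->
  exists U, [/\ Q U, (U0 <= U)%VS & forall W, Q W -> (U <= W)%VS -> W = U].
Proof.
have [n] := ubnP (\dim {:V} - \dim U0); elim: n U0 => // n IH U0.
rewrite ltnS => le_n QU0.
have [[W [QW UW neq]]|max] :=
  pselect (exists W, [/\ Q W, (U0 <= W)%VS & W <> U0]).
  have ltd : (\dim U0 < \dim W)%N.
    rewrite ltnNge; apply/negP => ge; apply: neq.
    by apply/eqP; rewrite eq_sym eqEdim UW.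
  have [|U [QU WU mU]] := IH W _ QW.
    apply: leq_trans le_n; rewrite ltn_sub2l //.
    by apply: leq_trans ltd _; apply: dimvS; apply: subvf.
  by exists U; split=> //; apply: subv_trans WU.
exists U0; split=> // W QW UW; apply: contrapT => neq; apply: max.
by exists W.
Qed.

(** A maximal subspace inside [P] absorbs the line of any vector satisfying [P], hence is all of
    [P]. *)
Lemma vspace_of_pred (P : V -> Prop) :
  P 0 -> (forall (c : K) x y, P x -> P y -> P (c *: x + y)) ->
  {U : {vspace V} | forall x, x \in U <-> P x}.
Proof.
move=> P0 PD; apply: cid.
have [|U [QU _ mU]] := @vspace_maximal (fun U => forall x, x \in U -> P x) 0%VS.
  by move=> x; rewrite memv0 => /eqP->.
exists U => x; split=> [/QU //|Px].
suff <- : (U + <[x]> = U)%VS by apply: (subvP (addvSr _ _)); apply: memv_line.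
apply: mU (addvSl _ _) => _ /memv_addP[u uU [_ /vlineP[c ->] ->]].
by rewrite addrC; apply: PD => //; apply: QU.
Qed.

Lemma span_free_subseq (s : seq V) :
  exists B : seq V, [/\ {subset B <= s}, free B & <<B>>%VS = <<s>>%VS].
Proof.
elim: s => [|x s [B [sB fB eB]]]; first by exists [::]; split=> //; apply: nil_free.
have [xs|xs] := boolP (x \in <<s>>%VS).
  exists B; split=> //; first by move=> y /sB; rewrite inE orbC => ->.
  by rewrite eB span_cons; apply/esym/addv_idPr; rewrite -memvE.
exists (x :: B); split; last by rewrite !span_cons eB.
  by move=> y; rewrite !inE => /orP[->//|/sB->]; rewrite orbT.
by rewrite free_cons eB xs fB.
Qed.

(* Subtracting the first eigenvalue from an operator kills the first component
   and rescales the others, so that induction on the number of components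
   applies. *)
Lemma stable_eigen_components (I : Type) (op : I -> 'End(V)) (E : eqType)
    (ev : E -> I -> K) U (s : seq E) (y : E -> V) :
  (forall i u, u \in U -> op i u \in U) ->
  (forall a b, a != b -> exists i, ev a i != ev b i) ->
  (forall a i, op i (y a) = ev a i *: y a) ->
  uniq s -> \sum_(a <- s) y a \in U ->
  forall a, a \in s -> y a \in U.
Proof.
move=> stU sep; elim: s y => [//|b s IH] y yE /= /andP[bs us].
rewrite big_cons => sumU.
have inU a : a \in s -> y a \in U.
  move=> as_; have [|i di] := sep a b; first by apply: contraNneq bs => <-.
  pose z c := (ev c i - ev b i) *: y c.
  have zU : z a \in U.
    apply: (IH z) => // [c j|].
      by rewrite linearZ /= yE !scalerA mulrC.
    have -> : \sum_(c <- s) z c =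
        op i (y b + \sum_(c <- s) y c) - ev b i *: (y b + \sum_(c <- s) y c).
      rewrite linearD /= yE scalerDr opprD addrACA subrr add0r linear_sum /=.
      rewrite scaler_sumr -sumrB; apply: eq_bigr => c _.
      by rewrite yE -scalerBl.
    by rewrite memvB ?stU ?memvZ.
  have -> : y a = (ev a i - ev b i)^-1 *: z a.
    by rewrite scalerA mulVf ?scale1r // subr_eq0.
  exact: memvZ.
move=> a; rewrite inE => /orP[/eqP->|/inU //].
rewrite -[y b](addrK (\sum_(c <- s) y c)) memvB // big_seq memv_suml // => c.
Qed.

Definition basis_trace n (B : n.-tuple V) (f : V -> V) : K :=
  \sum_(i < n) coord B i (f B`_i).

(** Expanding [h B_i] in [C] and [f C_j] in [B] gives the same double sum. Allowing two bases makes
    the lemma cover independence of the trace from the basis as well. *)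
Lemma basis_traceC n m (B : n.-tuple V) (C : m.-tuple V) (f h : 'End(V)) :
  basis_of fullv B -> basis_of fullv C ->
  basis_trace B (f \o h) = basis_trace C (h \o f).
Proof.
move=> bB bC; rewrite /basis_trace.
transitivity (\sum_(i < n) \sum_(j < m) coord C j (h B`_i) * coord B i (f C`_j)).
  apply: eq_bigr => i _.
  rewrite /= [in LHS](coord_basis bC (memvf (h B`_i))) !linear_sum /=.
  by apply: eq_bigr => j _; rewrite !linearZ.
rewrite exchange_big /=; apply: eq_bigr => j _.
rewrite /= [in RHS](coord_basis bB (memvf (f C`_j))) !linear_sum /=.
by apply: eq_bigr => i _; rewrite !linearZ /= mulrC.
Qed.

End LinearAlgebra.

(** * Simultaneous diagonalization of commuting operators *)

Section Eigenbasis.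
Variables (K : fieldType) (V : vectType K).

Lemma sum_fibers (I : finType) (E : eqType) (w : I -> E) (s : seq E) (F : I -> V) :
  uniq s -> (forall i, w i \in s) ->
  \sum_i F i = \sum_(a <- s) \sum_(i | w i == a) F i.
Proof.
move=> us ws; rewrite (exchange_big_dep xpredT) //=; apply: eq_bigr => i _.
rewrite -big_filter (eq_filter (a2 := pred1 (w i))) => [|a]; last exact: eq_sym.
by rewrite filter_pred1_uniq // big_seq1.
Qed.

Definition diagonalizable_end (f : 'End(V)) : Prop :=
  exists b : seq V, basis_of fullv b /\
    (forall v, v \in b -> exists c : K, f v = c *: v).

Definition joint_eigenvector (fs : seq 'End(V)) (v : V) : Prop :=
  forall f, f \in fs -> exists c : K, f v = c *: v.

(** Induction on [fs]: it suffices to put each joint eigenvector [b] of the tail in [U], and the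
    components of [b] under the new operator [t] are eigenvectors of the whole list. Quantifying
    over [U] stands for the span of a possibly infinite set. *)
Lemma joint_eigenvectors_span (fs : seq 'End(V)) (U : {vspace V}) :
  (forall f, f \in fs -> diagonalizable_end f) ->
  (forall f h, f \in fs -> h \in fs -> forall x, f (h x) = h (f x)) ->
  (forall v, joint_eigenvector fs v -> v \in U) -> U = fullv.
Proof.
elim: fs U => [|t fs IH] U diag comm inU.
  by apply/vspaceP => v; rewrite memvf inU.
apply: IH => [f ffs|f h ffs hfs|b jb].
- by apply: diag; rewrite inE ffs orbT.
- by apply: comm; rewrite inE ?ffs ?hfs orbT.
(* [W] is the common eigenspace of [fs] containing [b]; [t] preserves it by commutation, so it
   contains the [t]-components of [b]. *)
have [||W WP] := @vspace_of_pred K V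
    (fun x => forall f c, f \in fs -> f b = c *: b -> f x = c *: x).
- by move=> f c _ _; rewrite linear0 scaler0.
- move=> k x z Px Pz f c fin fb.
  by rewrite linearP /= (Px f c) // (Pz f c) // scalerDr !scalerA mulrC.
have [E [bE eE]] := diag t (mem_head _ _).
pose Et := in_tuple E.
have [ev evP] := boolp.choice (fun i : 'I_(size E) =>
  eE Et`_i (mem_nth 0 (ltn_ord i))).
pose s := undup (codom ev).
pose y c := \sum_(i | ev i == c) coord Et i b *: Et`_i.
have sumy : b = \sum_(c <- s) y c.
  rewrite {1}(coord_basis (X := Et) bE (memvf b)).
  by apply: sum_fibers => [|i]; rewrite ?undup_uniq // mem_undup codom_f.
have ty c : t (y c) = c *: y c.
  rewrite /y linear_sum scaler_sumr; apply: eq_bigr => i /eqP<-.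
  by rewrite linearZ /= evP !scalerA mulrC.
have yW : forall c, c \in s -> y c \in W.
  have stW (u : unit) x : x \in W -> t x \in W.
    move/WP=> Px; apply/WP => f c fin fb.
    by rewrite comm ?inE ?fin ?orbT ?eqxx // (Px f c) // linearZ.
  apply: (stable_eigen_components (ev := fun c _ => c) stW).
  - by move=> a c neq; exists tt.
  - by [].
  - exact: undup_uniq.
  - by rewrite -sumy; apply/WP.
rewrite sumy big_seq memv_suml // => c cs; apply: inU => f.
rewrite inE => /orP[/eqP->|fin]; first by exists c.
have [d fb] := jb f fin; exists d; have /WP := yW c cs.
exact.
Qed.

Lemma joint_eigenbasis (fs : seq 'End(V)) :
  (forall f, f \in fs -> diagonalizable_end f) ->
  (forall f h, f \in fs -> h \in fs -> forall x, f (h x) = h (f x)) ->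
  exists B : seq V, basis_of fullv B /\
    forall b, b \in B -> joint_eigenvector fs b.
Proof.
move=> diag comm.
pose Q U := exists s : seq V, U = <<s>>%VS /\ forall b, b \in s -> joint_eigenvector fs b.
have [|U [[s [Us js]] _ mU]] := @vspace_maximal K V Q 0%VS.
  by exists [::]; split; rewrite ?span_nil.
have Ufull : U = fullv.
  apply: (joint_eigenvectors_span diag comm) => v jv.
  suff <- : (<[v]> + U)%VS = U by apply: (subvP (addvSl _ _)); apply: memv_line.
  apply: mU (addvSr _ _); exists (v :: s); split; first by rewrite span_cons Us.
  by move=> b; rewrite inE => /orP[/eqP->|/js].
have [B [sB fB eB]] := span_free_subseq s.
exists B; split; first by rewrite /basis_of fB eB -Us Ufull eqxx.
by move=> b /sB /js.
Qed.

End Eigenbasis.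

(** * Bracket identities and first consequences of semisimplicity *)

Section Weights.
Variables (K : numFieldType) (L : vectType K) (br : L -> L -> L).
Variable T : {vspace L}.
Hypothesis ssL : semisimple br.
Hypothesis cartanT : cartan_subalgebra br T.
Implicit Types (a b : dual T) (x y z : L) (t : subvs_of T) (U W : {vspace L}).

Let br_bilinear (c : K) x y z :
  br (c *: x + y) z = c *: br x z + br y z /\
  br z (c *: x + y) = c *: br z x + br z y.
Proof. by case: ssL => [[_ lin _ _] _]; apply: lin; apply: memvf. Qed.

Lemma br_is_linear x : linear (br x).
Proof. by move=> c y z; have [_] := br_bilinear c y z x. Qed.

Definition ad x : 'End(L) := linfun (br x).
Lemma adE x y : ad x y = br x y.
Proof.
pose f : {linear L -> L} :=
  HB.pack (br x) (GRing.isLinear.Build K L L _ (br x) (br_is_linear x)).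
exact: (lfunE f).
Qed.

Lemma brDr x y z : br x (y + z) = br x y + br x z.
Proof. by rewrite -!adE linearD. Qed.
Lemma brBr x y z : br x (y - z) = br x y - br x z.
Proof. by rewrite -!adE linearB. Qed.
Lemma brZr x c y : br x (c *: y) = c *: br x y.
Proof. by rewrite -!adE linearZ. Qed.
Lemma brNr x y : br x (- y) = - br x y.
Proof. by rewrite -!adE linearN. Qed.
Lemma br0r x : br x 0 = 0.
Proof. by rewrite -!adE linear0. Qed.
Lemma br_sumr (I : Type) (r : seq I) (P : pred I) (F : I -> L) x :
  br x (\sum_(i <- r | P i) F i) = \sum_(i <- r | P i) br x (F i).
Proof. by rewrite -adE linear_sum; apply: eq_bigr => i _; rewrite /= adE. Qed.

Lemma brxx x : br x x = 0.
Proof. by case: ssL => [[_ _ alt _] _]; apply: alt; apply: memvf. Qed.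

Lemma brDl x y z : br (x + y) z = br x z + br y z.
Proof. by have [] := br_bilinear 1 x y z; rewrite !scale1r. Qed.

Lemma brC x y : br x y = - br y x.
Proof.
apply/eqP; rewrite -addr_eq0; apply/eqP.
by have := brxx (x + y); rewrite brDl !brDr !brxx add0r addr0.
Qed.

Lemma brZl x c y : br (c *: x) y = c *: br x y.
Proof. by rewrite brC brZr -scalerN -brC. Qed.
Lemma br0l x : br 0 x = 0. Proof. by rewrite brC br0r oppr0. Qed.

Lemma br_jacobi x y z : br x (br y z) = br (br x y) z + br y (br x z).
Proof.
case: ssL => [[_ _ _ jac] _]; have := jac x y z (memvf _) (memvf _) (memvf _).
rewrite (brC z x) brNr (brC z (br x y)) -addrA -opprD => /subr0_eq->.
exact: addrC.
Qed.

(** The form in which semisimplicity enters: an abelian ideal is solvable of length one. *)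
Lemma abelian_ideal0 U : (forall x y, y \in U -> br x y \in U) ->
  abelian_sub br U -> U = 0%VS.
Proof.
case: ssL => [lieL ss] idU abU; apply: ss; first by split=> // [|x y _]; [exact: subvf|exact: idU].
exists 1%N; apply/eqP; rewrite -subv0; apply: lie_prod_min => x y xU yU.
by rewrite abU ?mem0v.
Qed.

Lemma center0 x : (forall y, br y x = 0) -> x = 0.
Proof.
move=> cx; apply/eqP; rewrite -memv0 memvE.
rewrite (@abelian_ideal0 <[x]>%VS) ?subvv //.
  by move=> y _ /vlineP[c ->]; rewrite brZr cx scaler0 mem0v.
by move=> y _ _ /vlineP[c ->]; rewrite brZr cx scaler0.
Qed.

(** * Weight vectors and the weight decomposition under [T] *)

Local Notation wv := (@weight_vector K L br T).

Lemma weight_vectorP c a x y : wv a x -> wv a y -> wv a (c *: x + y).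
Proof.
by move=> ax ay t; rewrite brDr brZr ax ay scalerDr !scalerA mulrC.
Qed.
Lemma weight_vector0 a : wv a 0.
Proof. by move=> t; rewrite br0r scaler0. Qed.
Lemma weight_vectorZ c a x : wv a x -> wv a (c *: x).
Proof. by move=> /weight_vectorP ax; have := ax c _ (weight_vector0 a); rewrite addr0. Qed.
Lemma weight_vectorD a x y : wv a x -> wv a y -> wv a (x + y).
Proof. by move=> ax ay; rewrite -[x]scale1r; apply: weight_vectorP. Qed.
Lemma weight_vectorN a x : wv a x -> wv a (- x).
Proof. by rewrite -scaleN1r; apply: weight_vectorZ. Qed.
Lemma weight_vector_sum (I : Type) (r : seq I) (P : pred I) (F : I -> L) a :
  (forall i, P i -> wv a (F i)) -> wv a (\sum_(i <- r | P i) F i).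
Proof.
by move=> aF; elim/big_rec: _ => [|i x /aF]; [exact: weight_vector0|exact: weight_vectorD].
Qed.

Lemma weight_vector_br a b x y : wv a x -> wv b y -> wv (a + b) (br x y).
Proof.
by move=> ax by_ t; rewrite br_jacobi ax by_ brZl brZr -scalerDl lfunE.
Qed.

(** A vector [x] commuting with [T] makes [T + <[x]>] abelian, so maximality of [T] puts [x] in
    [T]. *)
Lemma weight_vector0P x : reflect (wv 0 x) (x \in T).
Proof.
have [abT maxT _] := cartanT; apply: (iffP idP) => [xT t|wx].
  by rewrite abT ?subvsP // lfunE scale0r.
have tx (s : L) : s \in T -> br s x = 0.
  by move=> sT; have := wx (vsproj T s); rewrite vsprojK // lfunE scale0r.
suff <- : (T + <[x]>)%VS = T by apply: (subvP (addvSr _ _)); apply: memv_line.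
apply: maxT (addvSl _ _) => y z /memv_addP[u uT [_ /vlineP[c ->] ->]].
move=> /memv_addP[v vT [_ /vlineP[d ->] ->]].
rewrite brDl !brDr !brZl !brZr abT // tx // brxx (brC x v) tx //.
by rewrite oppr0 !scaler0 !addr0.
Qed.

(** The coordinate along [x] reads off the eigenvalue, and does so linearly in [t]. *)
Lemma eigenvector_weight x : x != 0 ->
  (forall t, exists c : K, br (vsval t) x = c *: x) -> exists a, wv a x.
Proof.
move=> x0 ex; pose f (t : subvs_of T) : K^o := coord [tuple x] ord0 (br (vsval t) x).
have fl : linear f.
  by move=> c s t; rewrite /f linearP brDl brZl linearP.
pose F : {linear subvs_of T -> K^o} := HB.pack f (GRing.isLinear.Build _ _ _ _ f fl).
exists (linfun F) => t; rewrite lfunE /= /f; have [c ->] := ex t.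
have fx : free [tuple x] by rewrite seq1_free.
rewrite linearZ /= -[X in coord _ _ X]/([tuple x]`_(ord0 : 'I_1)) coord_free //.
by rewrite mulr1.
Qed.

Lemma weight_basis : exists B : seq L, basis_of fullv B /\
  forall x, x \in B -> exists a, wv a x.
Proof.
have [abT _ diagT] := cartanT.
have [f /mapP[t /vbasis_mem tT ->]||B [bB jB]] := @joint_eigenbasis K L (map ad (vbasis T)).
- have [b [bb eb]] := diagT t tT; exists b; split=> // v /eb[c e].
  by exists c; rewrite adE.
- move=> _ _ /mapP[t /vbasis_mem tT ->] /mapP[s /vbasis_mem sT ->] x.
  by rewrite !adE br_jacobi (abT t s) // br0l add0r.
exists B; split=> // x xB; apply: eigenvector_weight; first exact: basis_not0 bB xB.
have [||W WP] := @vspace_of_pred K L (fun s => exists c : K, br s x = c *: x).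
- by exists 0; rewrite br0l scale0r.
- move=> c s t [d sd] [e te]; exists (c * d + e).
  by rewrite brDl brZl sd te scalerA scalerDl.
have /subvP TW : (T <= W)%VS.
  rewrite -(span_basis (vbasisP T)); apply/span_subvP => s sB; apply/WP.
  by have [|c e] := jB x xB (ad s); rewrite ?map_f //; exists c; rewrite -adE.
by move=> t; apply/WP/TW; apply: subvsP.
Qed.

Lemma weight_decomposition : exists ws : seq (dual T),
  [/\ uniq ws, 0 \in ws & forall x, exists y : dual T -> L,
    [/\ forall a, wv a (y a), forall a, a \notin ws -> y a = 0 &
        x = \sum_(a <- ws) y a]].
Proof.
have [B [bB wB]] := weight_basis; pose Bt := in_tuple B.
have [w wP] := boolp.choice (fun i : 'I_(size B) =>
  wB Bt`_i (mem_nth 0 (ltn_ord i))).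
(* [0] is added by hand: it is an actual weight only when [T] is nonzero, and components are
   compared at weight [0] later. *)
exists (undup (0 :: codom w)); split=> [||x]; first exact: undup_uniq.
  by rewrite mem_undup mem_head.
exists (fun a => \sum_(i | w i == a) coord Bt i x *: Bt`_i); split=> [a|a|].
- by apply: weight_vector_sum => i /eqP <-; apply: weight_vectorZ.
- move=> aw; apply: big1 => i /eqP wi; case/negP: aw.
  by rewrite -wi mem_undup inE codom_f orbT.
rewrite {1}(coord_basis (X := Bt) bB (memvf x)).
by apply: sum_fibers => [|i]; rewrite ?undup_uniq // mem_undup inE codom_f orbT.
Qed.

Definition T_stable U := forall s x, s \in T -> x \in U -> br s x \in U.

Lemma dual_separation a b : a != b -> exists t, (a t : K) != b t.
Proof. by move/lfunPn=> [t tP]; exists t. Qed.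

Lemma stable_weight_components U (s : seq (dual T)) (y : dual T -> L) :
  T_stable U -> (forall a, wv a (y a)) -> uniq s ->
  \sum_(a <- s) y a \in U -> forall a, a \in s -> y a \in U.
Proof.
move=> stU wy us sU; apply: (stable_eigen_components
  (op := fun t => ad (vsval t)) (ev := fun a t => (a t : K))) us sU.
- by move=> t u uU; rewrite adE stU ?subvsP.
- exact: dual_separation.
- by move=> a t; rewrite adE wy.
Qed.

Lemma weight_components_inj (s : seq (dual T)) (y z : dual T -> L) :
  uniq s -> (forall a, wv a (y a)) -> (forall a, wv a (z a)) ->
  \sum_(a <- s) y a = \sum_(a <- s) z a -> forall a, a \in s -> y a = z a.
Proof.
move=> us wy wz eq a as_; apply/eqP; rewrite -subr_eq0 -memv0.
apply: (stable_weight_components (y := fun a => y a - z a)) as_ => //.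
- by move=> t x _; rewrite !memv0 => /eqP->; rewrite br0r.
- by move=> b; apply: weight_vectorD => //; apply: weight_vectorN.
- by rewrite sumrB eq subrr mem0v.
Qed.

Lemma weight_vector_unique a b x : x != 0 -> wv a x -> wv b x -> a = b.
Proof.
move=> x0 ax bx; apply/lfunP => t; apply/eqP; rewrite -subr_eq0.
have := etrans (esym (ax t)) (bx t); move/eqP; rewrite -subr_eq0 -scalerBl.
by rewrite scaler_eq0 (negPf x0) orbF.
Qed.

Lemma stable_decomposition : exists ws : seq (dual T),
  [/\ uniq ws, 0 \in ws,
      forall a x, x != 0 -> wv a x -> a \in ws &
      forall U x, T_stable U -> x \in U -> exists y : dual T -> L,
        [/\ forall a, wv a (y a), forall a, y a \in U &
            x = \sum_(a <- ws) y a]].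
Proof.
have [ws [us ws0 dec]] := weight_decomposition; exists ws; split=> // [a x x0 ax|U x stU xU].
  apply/negP => /negP aws; case/negP: x0; have [y [wy _ xE]] := dec x.
  (* Were [a] missing from [ws], the family [z] would sum to [0] over [a :: ws], so its component
     [- x] at [a] would vanish. *)
  pose z b := if b == a then - x else y b.
  have : z a \in (0%VS : {vspace L}).
    apply: (@stable_weight_components 0%VS (a :: ws)); rewrite ?mem_head //=.
    - by move=> s u _; rewrite !memv0 => /eqP->; rewrite br0r.
    - move=> b; rewrite /z; case: eqP => // ->; exact: weight_vectorN.
    - by rewrite aws.
    - rewrite big_cons {1}/z eqxx {1}xE memv0 addrC subr_eq0; apply/eqP.
      apply: eq_big_seq => b bws; rewrite /z; case: eqP => // ba.
      by rewrite -ba bws in aws.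
  by rewrite memv0 /z eqxx oppr_eq0.
have [y [wy y0 xE]] := dec x; exists y; split=> // a.
have [aws|/y0->] := boolP (a \in ws); last exact: mem0v.
by apply: stable_weight_components aws; rewrite // -xE.
Qed.

Lemma weight_vector_iter a b x v n :
  wv a x -> wv b v -> wv (b + a *+ n) (iter n (br x) v).
Proof.
move=> ax bv; elim: n => [|n IH]; first by rewrite mulr0n addr0.
by rewrite iterS mulrS addrCA; apply: weight_vector_br.
Qed.

(* The successive weights [b + n a] are distinct and there are finitely many
   weights. *)
Lemma ad_orbit_enters a b x v U : a != 0 -> wv a x -> wv b v -> v \notin U ->
  exists n, iter n (br x) v \notin U /\ iter n.+1 (br x) v \in U.
Proof.
move=> a0 ax bv vU; apply: contrapT => none.
have out n : iter n (br x) v \notin U.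
  by elim: n => // n IH; apply/negP => inU; apply: none; exists n.
have [ws [_ _ wsP _]] := stable_decomposition.
pose f n := b + a *+ n.
have : uniq (map f (iota 0 (size ws).+1)).
  rewrite map_inj_uniq ?iota_uniq // => m n /addrI.
  rewrite -!(scaler_nat _ a) => /eqP; rewrite -subr_eq0 -scalerBl scaler_eq0.
  by rewrite (negPf a0) orbF subr_eq0 eqr_nat => /eqP.
move/uniq_leq_size => /(_ ws); rewrite size_map size_iota ltnn => bound.
suff /bound : {subset map f (iota 0 (size ws).+1) <= ws} by [].
move=> _ /mapP[n _ ->]; apply: (wsP _ (iter n (br x) v)).
  by apply: contraNneq (out n) => ->; apply: mem0v.
exact: weight_vector_iter.
Qed.

Lemma dual_addMn a b n t :
  ((b + a *+ n) t : K) = (b t : K) + (a t : K) *+ n.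
Proof.
rewrite add_lfunE; congr (_ + _); elim: n => [|n IH]; first by rewrite lfunE.
by rewrite !mulrS add_lfunE IH.
Qed.

Lemma dualN a t : ((- a) t : K) = - (a t : K).
Proof. by rewrite opp_lfunE. Qed.

(** * Strings and integrality for sl2-triples *)

Section Sl2String.
Variables (a : dual T) (e f : L) (h : subvs_of T).
Hypotheses (a0 : a != 0) (ae : wv a e) (af : wv (- a) f) (hE : vsval h = br e f).

(** Commuting [e] past the factors [f] adds up the values of [b - i a] at [h] for [i <= k]; the
    factor 2 clears the denominator of this arithmetic sum. The triple is not normalized: [a h] may
    be any scalar, even 0. *)
Lemma sl2_lowering b v k : wv b v -> br e v = 0 ->
  2%:R *: br e (iter k.+1 (br f) v) =
  (k.+1%:R * (2%:R * b h - k%:R * a h)) *: iter k (br f) v.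
Proof.
move=> bv ev0; elim: k => [|k IH].
  by rewrite /= br_jacobi ev0 br0r addr0 -hE bv scalerA mul1r mul0r subr0.
rewrite iterS br_jacobi -hE scalerDr -(brZr f) IH brZr -iterS.
rewrite (weight_vector_iter k.+1 af bv) scalerA -scalerDl dual_addMn dualN.
congr (_ *: _); rewrite -[(- (a h : K)) *+ _]mulr_natr -!natr1.
by ring.
Qed.

(** The [f]-string through [v] is finite; at its last nonzero vector the coefficient in
    [sl2_lowering] must vanish. *)
Lemma sl2_highest_weight b v : wv b v -> v != 0 -> br e v = 0 ->
  exists k : nat, 2%:R * (b h : K) = k%:R * (a h : K).
Proof.
move=> bv v0 ev0.
have [||k] := ad_orbit_enters (x := f) (U := 0%VS) _ af bv.
- by rewrite oppr_eq0.
- by rewrite memv0.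
rewrite !memv0 => -[n0 /eqP z]; exists k.
have := sl2_lowering k bv ev0; rewrite z br0r scaler0 => /esym/eqP.
by rewrite scaler_eq0 (negPf n0) orbF mulf_eq0 pnatr_eq0 /= subr_eq0 => /eqP.
Qed.

Lemma sl2_weight_integral b v : wv b v -> v != 0 ->
  exists z : int, 2%:R * (b h : K) = z%:~R * (a h : K).
Proof.
move=> bv v0; have [|n] := ad_orbit_enters (U := 0%VS) a0 ae bv.
  by rewrite memv0.
rewrite !memv0 => -[n0 /eqP z].
have [k] := sl2_highest_weight (weight_vector_iter n ae bv) n0 z.
(* Raising [v] to a highest weight vector of weight [b + n a] adds [n] times [a h], whence the shift
   by [2 n]. *)
rewrite dual_addMn => e2; exists (k%:Z - n.*2%:Z).
rewrite intrD rmorphN /= mulrBl -!pmulrn -e2 -mul2n natrM -[(a h : K) *+ n]mulr_natr.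
by ring.
Qed.
End Sl2String.

(** Exchanging [e] and [f] turns the triple for [a] into one for [- a], with [h] negated. *)
Lemma sl2_lowest_weight a e f h b v :
  a != 0 -> wv a e -> wv (- a) f -> vsval h = br e f ->
  wv b v -> v != 0 -> br f v = 0 ->
  exists k : nat, 2%:R * (b h : K) = - k%:R * (a h : K).
Proof.
move=> a0 ae af hE bv v0 fv0.
have na0 : - a != 0 by rewrite oppr_eq0.
have nae : wv (- - a) e by rewrite opprK.
have hE' : vsval (- h) = br f e by rewrite linearN /= hE -brC.
have [k kE] := sl2_highest_weight na0 nae hE' bv v0 fv0.
exists k; move: kE; rewrite dualN !linearN /= opprK mulrN => kE.
by rewrite mulNr -kE opprK.
Qed.

(** * The Killing form: invariance and isotropic vectors of the torus *)

Local Notation kf := (killing br).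

Lemma killing_trace x y : kf x y = basis_trace (vbasis {:L}) (ad x \o ad y).
Proof. by apply: eq_bigr => i _; rewrite /= !adE. Qed.

Lemma killingC x y : kf x y = kf y x.
Proof. by rewrite !killing_trace; apply: basis_traceC; apply: vbasisP. Qed.

Lemma killingPr x c y z : kf x (c *: y + z) = c * kf x y + kf x z.
Proof.
rewrite /killing mulr_sumr -big_split; apply: eq_bigr => i _ /=.
by rewrite brDl brZl brDr brZr linearP.
Qed.

Lemma killingDr x y z : kf x (y + z) = kf x y + kf x z.
Proof. by rewrite -[y]scale1r killingPr mul1r scale1r. Qed.
Lemma killing0r x : kf x 0 = 0.
Proof. by apply: (addrI (kf x 0)); rewrite -killingDr !addr0. Qed.
Lemma killingZr x c y : kf x (c *: y) = c * kf x y.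
Proof. by rewrite -[_ *: _]addr0 killingPr killing0r addr0. Qed.
Lemma killing0l x : kf 0 x = 0. Proof. by rewrite killingC killing0r. Qed.
Lemma killingZl c x y : kf (c *: x) y = c * kf x y.
Proof. by rewrite killingC killingZr killingC. Qed.
Lemma killingNl x y : kf (- x) y = - kf x y.
Proof. by rewrite -scaleN1r killingZl mulN1r. Qed.
Lemma killingBl x y z : kf (x - y) z = kf x z - kf y z.
Proof. by rewrite killingC killingDr killingC -killingNl (killingC z). Qed.
Lemma killing_sumr (I : Type) (r : seq I) (P : pred I) (F : I -> L) x :
  kf x (\sum_(i <- r | P i) F i) = \sum_(i <- r | P i) kf x (F i).
Proof.
by apply: (big_morph (kf x)) => [y z|]; [exact: killingDr|exact: killing0r].
Qed.

(** With the brackets expanded, the two sides differ by the trace of a commutator of [ad y] with the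
    product of [ad x] and [ad z]. *)
Lemma killing_invariant x y z : kf (br x y) z = kf x (br y z).
Proof.
pose B := vbasis {:L}; have bB : basis_of fullv B := vbasisP _.
have tC : basis_trace B (ad y \o (ad x \o ad z)%VF) =
          basis_trace B ((ad x \o ad z)%VF \o ad y) by apply: basis_traceC.
apply/eqP; rewrite -subr_eq0; apply/eqP.
transitivity (basis_trace B ((ad x \o ad z)%VF \o ad y) -
              basis_trace B (ad y \o (ad x \o ad z)%VF)); last by rewrite tC subrr.
rewrite /killing /basis_trace -!sumrB; apply: eq_bigr => i _.
rewrite /= !comp_lfunE !adE -!linearB /=; congr (coord _ _ _).
have -> : br (br x y) (br z B`_i) =
    br x (br y (br z B`_i)) - br y (br x (br z B`_i)).
  by rewrite (br_jacobi x y) addrK.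
have -> : br (br y z) B`_i = br y (br z B`_i) - br z (br y B`_i).
  by rewrite (br_jacobi y z) addrK.
by rewrite brBr opprB addrC addrA subrK.
Qed.

Lemma killing_weights a b x y : wv a x -> wv b y -> a + b != 0 -> kf x y = 0.
Proof.
move=> ax by_ ab0; have [t] := dual_separation ab0.
rewrite add_lfunE zero_lfunE => nz; apply/eqP.
have := killing_invariant x (vsval t) y.
rewrite brC ax by_ killingNl killingZl killingZr => /esym/eqP.
by rewrite -subr_eq0 opprK -mulrDl addrC mulf_eq0 (negPf nz).
Qed.

(* On the torus the Killing form is the sum of the squares of the weights. *)
Lemma torus_isotropic0 h (c : K) :
  (forall b v, v != 0 -> wv b v ->
     exists z : int, 2%:R * (b h : K) = z%:~R * c) ->
  kf (vsval h) (vsval h) = 0 -> h = 0.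
Proof.
move=> int0 kh0; have [B [bB wB]] := weight_basis; pose Bt := in_tuple B.
have [w wP] := boolp.choice (fun i : 'I_(size B) =>
  wB Bt`_i (mem_nth 0 (ltn_ord i))).
have Bi0 (i : 'I_(size B)) : Bt`_i != 0 by apply: basis_not0 bB (mem_nth 0 (ltn_ord i)).
have [z zP] := boolp.choice (fun i => int0 _ _ (Bi0 i) (wP i)).
have sumw : \sum_i (w i h : K) ^+ 2 = 0.
  rewrite -[RHS]kh0 killing_trace (basis_traceC _ _ (vbasisP _) (bB : basis_of _ Bt)).
  rewrite /basis_trace; apply: eq_bigr => i _; rewrite /= !adE !wP brZr wP scalerA linearZ /=.
  by rewrite coord_free ?(basis_free bB) // eqxx mulr1 expr2.
(* Squares in [K] need not be nonnegative; after multiplication by 4, integrality turns the sum into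
   one of squares of integers, times [c ^+ 2]. *)
have sumz : (\sum_i (z i)%:~R ^+ 2 : K) * c ^+ 2 = 0.
  rewrite mulr_suml -[RHS](mulr0 (2%:R ^+ 2)) -[in RHS]sumw mulr_sumr.
  by apply: eq_bigr => i _; rewrite -!exprMn zP.
have w0 i : (w i h : K) = 0.
  have : 2%:R * (w i h : K) = 0.
    move/eqP: sumz; rewrite zP mulf_eq0 expf_eq0 /=.
    move=> /orP[|/eqP->]; last by rewrite mulr0.
    rewrite psumr_eq0 => [|j _]; last by rewrite real_exprn_even_ge0 ?realz.
    by move=> /allP/(_ i (mem_index_enum _)); rewrite expf_eq0 /= => /eqP->; rewrite mul0r.
  by move/eqP; rewrite mulf_eq0 pnatr_eq0 => /eqP.
apply/val_inj/center0 => y; rewrite brC (coord_basis (X := Bt) bB (memvf y)).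
rewrite br_sumr big1 ?oppr0 // => i _.
by rewrite brZr wP w0 scale0r scaler0.
Qed.

(** * The graded Engel theorem and nondegeneracy of the Killing form *)

Lemma weight_vector_torus a x s : wv a x -> s \in T -> exists c : K, br s x = c *: x.
Proof. by move=> ax sT; exists (a (vsproj T s)); rewrite -ax vsprojK. Qed.

Lemma stable_weight_vector_notin U W : T_stable W -> ~~ (W <= U)%VS ->
  exists a v, [/\ wv a v, v \in W & v \notin U].
Proof.
move=> stW /subvPn[x xW xU]; have [ws [_ _ _ dec]] := stable_decomposition.
have [y [wy yW xE]] := dec W x stW xW; apply: contrapT => none.
case/negP: xU; rewrite xE memv_suml // => a _; apply/negPn/negP => yaU.
by apply: none; exists a, (y a).
Qed.

(* Engel's theorem for a [T]-stable subalgebra without zero weight: its weight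
   vectors act nilpotently because they shift weights. *)
Lemma graded_engel D :
  T_stable D -> (forall x y, x \in D -> y \in D -> br x y \in D) ->
  (forall x, x \in D -> wv 0 x -> x = 0) -> D != 0%VS ->
  exists v, [/\ v \in D, v != 0 & forall x, x \in D -> br x v = 0].
Proof.
move=> stD subD D0 Dn0.
pose stable (M W : {vspace L}) := forall m w, m \in M -> w \in W -> br m w \in W.
(* The induction needs this relative form: [U = M] and [W = D] gives a vector by which [M] can be
   enlarged, while [U = 0] and [W = D] gives the conclusion once [M] is all of [D]. *)
pose engel (M : {vspace L}) := forall U W, T_stable U -> T_stable W -> stable M U -> stable M W ->
  ~~ (W <= U)%VS ->
  exists a v, [/\ wv a v, v \in W, v \notin U & forall m, m \in M -> br m v \in U].
have [|M [[MD stM subM eM] _ maxM]] := @vspace_maximal K L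
  (fun M : {vspace L} => [/\ (M <= D)%VS, T_stable M, stable M M & engel M]) 0%VS.
  split; first exact: sub0v.
  - by move=> s x _; rewrite !memv0 => /eqP->; rewrite br0r.
  - by move=> x y _; rewrite !memv0 => /eqP->; rewrite br0r.
  move=> U W _ stW _ _ WU; have [a [v [av vW vU]]] := stable_weight_vector_notin stW WU.
  by exists a, v; split=> // m; rewrite memv0 => /eqP->; rewrite br0l mem0v.
have [DM|DM] := boolP (D <= M)%VS; last first.
  have stDM : stable M D by move=> m d mM; apply: subD; apply: (subvP MD).
  have [a [x [ax xD xM Mx]]] := eM M D stM stD subM stDM DM.
  have a0 : a != 0.
    apply: contraNneq xM => a0; rewrite a0 in ax.
    by rewrite (D0 x xD ax) mem0v.
  suff eqM : (M + <[x]>)%VS = M.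
    by case/negP: xM; rewrite -eqM; apply: (subvP (addvSr _ _)); apply: memv_line.
  apply: maxM (addvSl _ _); split.
  - by rewrite subv_add MD -memvE.
  - move=> s _ sT /memv_addP[u uM [_ /vlineP[c ->] ->]].
    have [d xd] := weight_vector_torus ax sT.
    rewrite brDr brZr xd memv_add ?stM // scalerA; apply/vlineP.
    by exists (c * d).
  - move=> y z /memv_addP[u uM [_ /vlineP[c ->] ->]] /memv_addP[v vM [_ /vlineP[d ->] ->]].
    apply: (subvP (addvSl _ _)).
    rewrite brDl !brDr !brZl !brZr brxx (brC x v).
    by rewrite !scaler0 addr0 !(memvD, memvZ, memvN, Mx, subM).
  move=> U W stU stW MU MW WU.
  have sM : (M <= M + <[x]>)%VS by apply: addvSl.
  have xM' : x \in (M + <[x]>)%VS.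
    by apply: (subvP (addvSr _ _)); apply: memv_line.
  have MU' : stable M U by move=> m w mM; apply: MU; apply: (subvP sM).
  have MW' : stable M W by move=> m w mM; apply: MW; apply: (subvP sM).
  have [b [v [bv vW vU Mv]]] := eM U W stU stW MU' MW' WU.
  (* The last vector of the [x]-orbit outside [U] is sent into [U] by [x]; [M] also sends it there,
     because [[M, x]] lies in [M] and [U] is stable under [x]. *)
  have [n [out inn]] := ad_orbit_enters a0 ax bv vU.
  have [nW nM] : iter n (br x) v \in W /\
      (forall m, m \in M -> br m (iter n (br x) v) \in U).
    elim: (n) => [|k [kW kM]] //=; split; first exact: MW.
    move=> m mM; rewrite br_jacobi memvD // ?kM ?Mx //.
    by apply: MU => //; apply: kM.
  exists (b + a *+ n), (iter n (br x) v); split=> //.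
    exact: weight_vector_iter.
  move=> _ /memv_addP[u uM [_ /vlineP[c ->] ->]].
  by rewrite brDl brZl; apply: memvD; [exact: nM|exact: memvZ].
have [||||a [v [_ vD v0 Mv]]] := eM 0%VS D _ stD.
- by move=> s x _; rewrite !memv0 => /eqP->; rewrite br0r.
- by move=> s x _; rewrite !memv0 => /eqP->; rewrite br0r.
- by move=> m d mM; apply: subD; apply: (subvP MD).
- by rewrite subv0.
exists v; split; rewrite -?memv0 // => x xD.
by apply/eqP; rewrite -memv0; apply/Mv/(subvP DM).
Qed.

(** The centre of [D] is an abelian ideal of the whole algebra, hence zero, whereas [graded_engel]
    gives it a nonzero vector. *)
Lemma graded_ideal0 D : T_stable D -> (forall x y, y \in D -> br x y \in D) ->
  (forall x, x \in D -> wv 0 x -> x = 0) -> D = 0%VS.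
Proof.
move=> stD idD D0; apply/eqP/negPn/negP => Dn0.
have [|v [vD v0 Dv]] := graded_engel stD _ D0 Dn0; first by move=> x y _; apply: idD.
have [||Z ZP] := @vspace_of_pred K L
  (fun v => v \in D /\ forall d, d \in D -> br d v = 0).
- by split; [exact: mem0v|move=> d _; rewrite br0r].
- move=> c x y [xD xZ] [yD yZ]; split; first by rewrite memvD ?memvZ.
  by move=> d dD; rewrite brDr brZr xZ // yZ // scaler0 addr0.
case/eqP: v0; apply/eqP; rewrite -memv0.
rewrite -(@abelian_ideal0 Z); first by apply/ZP.
  move=> x y /ZP[yD yZ]; apply/ZP; split; first exact: idD.
  move=> d dD; rewrite br_jacobi yZ; last by rewrite brC memvN idD.
  by rewrite yZ // br0r addr0.
by move=> x y /ZP[xD _] /ZP[_ ->].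
Qed.

Lemma killing_nondegenerate x : (forall y, kf x y = 0) -> x = 0.
Proof.
have [||S SP] := @vspace_of_pred K L (fun x => forall y, kf x y = 0).
- by move=> y; rewrite killing0l.
- by move=> c z w Sz Sw y; rewrite killingC killingPr !(killingC y) Sz Sw mulr0 addr0.
have idS z y : y \in S -> br z y \in S.
  move=> /SP Sy; apply/SP => w.
  by rewrite brC killingNl killing_invariant Sy oppr0.
have [abT _ _] := cartanT.
(* For [z] in the radical [S], the torus element [h = [z, y]] is isotropic by invariance. The string
   argument makes the weights at [h] half-integral multiples of [a h], so [h = 0]. *)
have SL0 a z y : z \in S -> wv a z -> wv (- a) y -> br z y = 0.
  move=> /SP Sz az ay; have [a0|a0] := eqVneq a 0.
    by rewrite a0 oppr0 in az ay; rewrite abT //; apply/weight_vector0P.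
  have zyT : br z y \in T.
    by apply/weight_vector0P; rewrite -(subrr a); apply: weight_vector_br.
  have hE : vsval (vsproj T (br z y)) = br z y by rewrite vsprojK.
  suff h0 : vsproj T (br z y) = 0 by rewrite -hE h0 linear0.
  apply: (torus_isotropic0 (c := a (vsproj T (br z y)))) => [b v v0 bv|].
    exact: sl2_weight_integral a0 az ay hE _ _ bv v0.
  by rewrite hE killing_invariant Sz.
have stS : T_stable S by move=> s y _; apply: idS.
have [ws [us ws0 wsP dec]] := stable_decomposition.
(* [D] is the part of [S] outside weight [0]. It is an ideal because [SL0] kills the brackets that
   would fall into weight [0]. *)
pose inD z := exists y : dual T -> L,
  [/\ forall a, wv a (y a), forall a, y a \in S, y 0 = 0 & z = \sum_(a <- ws) y a].
have [||D DP] := @vspace_of_pred K L inD.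
- exists (fun=> 0); split=> // [a|a|]; rewrite ?mem0v //; first exact: weight_vector0.
  by rewrite big1.
- move=> c _ _ [y [wy yS y0 ->]] [z [wz zS z0 ->]].
  exists (fun a => c *: y a + z a); split=> [a|a||].
  + exact: weight_vectorP.
  + by rewrite memvD ?memvZ.
  + by rewrite y0 z0 scaler0 addr0.
  + by rewrite scaler_sumr -big_split.
have wD a z : a != 0 -> wv a z -> z \in S -> z \in D.
  move=> a0 az zS; have [->|z0] := eqVneq z 0; first exact: mem0v.
  apply/DP; exists (fun b => if b == a then z else 0); split=> [b|b||].
  + by case: eqP => [->//|_]; apply: weight_vector0.
  + by case: eqP => // _; apply: mem0v.
  + by rewrite eq_sym (negPf a0).
  + rewrite -big_mkcond -big_filter filter_pred1_uniq ?big_seq1 //.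
    exact: wsP az.
have idD z w : w \in D -> br z w \in D.
  move=> /DP[y [wy yS y0 ->]].
  have [u [wu _ ->]] := dec _ z (fun s x _ _ => memvf (br s x)) (memvf z).
  rewrite br_sumr memv_suml // => a _; rewrite brC br_sumr -sumrN memv_suml // => b _.
  rewrite -brC; have [ab0|ab0] := eqVneq (b + a) 0.
    rewrite brC (SL0 a) ?oppr0 ?mem0v //.
    by have -> : - a = b by apply/eqP; rewrite eq_sym -addr_eq0 ab0.
  by apply: wD ab0 _ _; [exact: weight_vector_br|exact: idS].
have D0 : D = 0%VS.
  apply: graded_ideal0 => // [s z _|z /DP[y [wy yS y0 zE]] z0]; first exact: idD.
  have eqs : \sum_(a <- ws) y a = \sum_(a <- ws) (if a == 0 then z else 0).
    by rewrite -zE -big_mkcond -big_filter filter_pred1_uniq ?big_seq1.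
  have := weight_components_inj us wy _ eqs ws0; rewrite y0 eqxx => -> // a.
  by case: eqP => [->//|_]; apply: weight_vector0.
have ST z : z \in S -> z \in T.
  move=> zS; have [y [wy yS ->]] := dec S z stS zS.
  rewrite memv_suml // => a _; have [a0|a0] := eqVneq a 0.
    by apply/weight_vector0P; rewrite -{1}a0.
  have := wD a (y a) a0 (wy a) (yS a).
  by rewrite D0 memv0 => /eqP->; apply: mem0v.
move=> /SP xS; apply/eqP; rewrite -memv0 -(@abelian_ideal0 S) //.
by move=> z y zS yS; apply: abT; apply: ST.
Qed.

Lemma torus_nondegenerate x :
  x \in T -> (forall s, s \in T -> kf x s = 0) -> x = 0.
Proof.
move=> xT xs0; apply: killing_nondegenerate => y.
have [ws [us ws0 wsP dec]] := stable_decomposition.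
have [u [wu _ ->]] := dec fullv y (fun s x _ _ => memvf _) (memvf y).
rewrite killing_sumr big1 // => a _; have [a0|a0] := eqVneq a 0.
  by apply: xs0; apply/weight_vector0P; rewrite -{1}a0.
apply: (@killing_weights 0 a) => //; last by rewrite add0r.
exact/weight_vector0P.
Qed.

(** * Root spaces and coroots *)

Lemma killing_dual_vector a x : wv a x -> x != 0 ->
  exists y, wv (- a) y /\ kf x y = 1.
Proof.
move=> ax x0; apply: contrapT => none; case/eqP: x0.
apply: killing_nondegenerate => y.
have [ws [us ws0 wsP dec]] := stable_decomposition.
have [u [wu _ ->]] := dec fullv y (fun s x _ _ => memvf _) (memvf y).
rewrite killing_sumr big1 // => b _; have [ab0|ab0] := eqVneq (a + b) 0; last first.
  exact: killing_weights (wu b) ab0.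
apply/eqP/negP => /negP nz; apply: none; exists ((kf x (u b))^-1 *: u b).
rewrite killingZr mulVf //; split=> //; apply: weight_vectorZ.
by rewrite (addr0_eq ab0).
Qed.

(** With [f] normalized by [kf e f = 1], the bracket [s = [e, f]] represents [a] for the Killing
    form; if [a s] were 0, [s] would be isotropic and hence 0. *)
Lemma root_sl2 a e : a != 0 -> wv a e -> e != 0 -> exists f (s : subvs_of T),
  [/\ wv (- a) f, vsval s = br e f, (a s : K) != 0,
      forall t, kf (vsval s) (vsval t) = a t &
      forall x, wv a x -> x \in <[e]>%VS].
Proof.
move=> a0 ae e0; have [f [af kef]] := killing_dual_vector ae e0.
have inT x : wv a x -> br x f \in T.
  by move=> ax; apply/weight_vector0P; rewrite -(subrr a); apply: weight_vector_br.
have kfT x t : wv a x -> kf (br x f) (vsval t) = (a t : K) * kf x f.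
  move=> ax; rewrite killing_invariant brC af killingC killingNl killingZl.
  by rewrite dualN mulNr opprK killingC.
pose s := vsproj T (br e f); have sE : vsval s = br e f by rewrite vsprojK ?inT.
have ks t : kf (vsval s) (vsval t) = a t by rewrite sE kfT // kef mulr1.
have as0 : (a s : K) != 0.
  apply/negP => /eqP as0; case/negP: (a0); have s0 : s = 0.
    apply: (torus_isotropic0 (c := a s)) => [b v v0 bv|]; last by rewrite ks as0.
    exact: sl2_weight_integral a0 ae af sE _ _ bv v0.
  apply/eqP/lfunP => t; rewrite -[LHS]ks s0 zero_lfunE.
  by rewrite [vsval 0]linear0 killing0l.
(* Subtracting the multiple of [e] seen by [f] leaves [x'] orthogonal to [f], hence commuting with
   it. If nonzero, it is a lowest weight vector of weight [a], forcing [(k + 2) * a s = 0] for a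
   natural [k]. *)
exists f, s; split=> // x ax; pose x' := x - kf x f *: e.
have ax' : wv a x' by apply: weight_vectorD => //; apply/weight_vectorN/weight_vectorZ.
have x'f : br x' f = 0.
  apply: torus_nondegenerate (inT _ ax') _ => t tT.
  by rewrite -(vsprojK tT) kfT // killingBl killingZl kef mulr1 subrr mulr0.
have [x'0|x'0] := eqVneq x' 0.
  by apply/vlineP; exists (kf x f); apply/eqP; rewrite -subr_eq0 -/x' x'0.
have [|k /eqP] := sl2_lowest_weight a0 ae af sE ax' x'0; first by rewrite brC x'f oppr0.
rewrite mulNr -subr_eq0 opprK -mulrDl -natrD mulf_eq0 pnatr_eq0.
by rewrite (negPf as0) orbF add2n.
Qed.

Local Notation is_root := (@is_root K L br T).

Lemma root_space_line a e x : is_root a -> wv a e -> e != 0 -> wv a x ->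
  x \in <[e]>%VS.
Proof. by move=> [a0 _] ae e0 ax; have [f [s [_ _ _ _]]] := root_sl2 a0 ae e0; apply. Qed.

Lemma is_rootN a : is_root a -> is_root (- a).
Proof.
move=> [a0 [x x0 ax]]; split; first by rewrite oppr_eq0.
have [y [ay kxy]] := killing_dual_vector ax x0; exists y => //.
by apply: contra_eq_neq kxy => ->; rewrite killing0r eq_sym oner_eq0.
Qed.

Lemma weight_vector_root a x : wv a x -> x != 0 -> a = 0 \/ is_root a.
Proof.
by move=> ax x0; have [->|a0] := eqVneq a 0; [left|right; split=> //; exists x].
Qed.

(** [h] is the representative [s] of [a] rescaled by [2 / a s]. When [b h < 0], a vector of weight
    [b] is not killed by [e], since a highest weight is nonnegative at [h]. An ideal with a vector
    of weight [a] contains [e], and [h] is a bracket with [e]. *)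
Lemma coroot a : is_root a -> exists h : subvs_of T,
  [/\ (a h : K) = 2%:R,
      forall b, is_root b -> exists z : int, (b h : K) = z%:~R,
      forall b, is_root b -> (b h : K) < 0 -> a + b = 0 \/ is_root (a + b),
      forall b, (b h : K) = 0 -> orthogonal_roots br a b &
      forall U, (forall x y, y \in U -> br x y \in U) ->
        (exists x, [/\ wv a x, x != 0 & x \in U]) -> vsval h \in U].
Proof.
move=> ra; have [a0 [e e0 ae]] := ra.
have [f [s [af sE as0 ks line]]] := root_sl2 a0 ae e0.
pose c := 2%:R / (a s : K); pose h := c *: s.
have c0 : c != 0 by rewrite mulf_neq0 ?invr_eq0 // pnatr_eq0.
have hE b : (b h : K) = c * (b s : K) by rewrite linearZ.
have ah : (a h : K) = 2%:R by rewrite hE /c mulfVK.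
have af' : wv (- a) (c *: f) by apply: weight_vectorZ.
have hef : vsval h = br e (c *: f) by rewrite brZr -sE linearZ.
have n20 : 2%:R != 0 :> K by rewrite pnatr_eq0.
exists h; split=> // [b [b0 [v v0 bv]]|b [b0 [v v0 bv]] bneg|b bh0|U idU [x [ax x0 xU]]].
- have [z] := sl2_weight_integral a0 ae af' hef bv v0.
  by rewrite ah mulrC => /(mulIf n20); exists z.
- have [ev0|ev0] := eqVneq (br e v) 0.
    have [k] := sl2_highest_weight a0 af' hef bv v0 ev0.
    rewrite ah mulrC => /(mulIf n20) bk; move: bneg; rewrite bk.
    by rewrite le_gtF ?ler0n.
  by apply: weight_vector_root ev0; apply: weight_vector_br.
- exists s => //; apply/eqP; move/eqP: bh0; rewrite hE mulf_eq0 (negPf c0).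
  by [].
- rewrite hef brC memvN idU //; have [k ->] : exists k, e = k *: x.
    by apply/vlineP; apply: root_space_line ra ax x0 ae.
  exact: memvZ.
Qed.

(** * The order on roots defined by a positive system *)

Section PositiveSystem.
Variables (Rp : {fset dual T}) (X : dual T -> L).
Hypotheses (posR : positive_system br Rp) (rootX : root_vectors br Rp X).

Lemma pos_root a : a \in Rp -> is_root a.
Proof. by case: posR => rootR _ _; apply: rootR. Qed.

Lemma pos_rootN a : a \in Rp -> - a \notin Rp.
Proof. by move=> aR; have [_ /(_ a (pos_root aR)) + _] := posR; rewrite aR. Qed.

Lemma root_pos_or_neg a : is_root a -> a \in Rp \/ - a \in Rp.
Proof.
by move=> ra; have [_ /(_ a ra) + _] := posR; case: (a \in Rp) => /= h; [left|right].
Qed.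

Lemma pos_root_add a b : a \in Rp -> b \in Rp -> is_root (a + b) -> a + b \in Rp.
Proof. by case: posR => _ _; apply. Qed.

Lemma pos_root_neq0 a : a \in Rp -> a != 0.
Proof. by move/pos_root => []. Qed.

(* Evaluating a vanishing sum at the coroot of one of its terms gives
   [0 = 2 + ...] with integers, so another term is negative there; the two can
   be merged into a single positive root. *)
Lemma sum_pos_roots_neq0 (s : seq (dual T)) :
  s != [::] -> {subset s <= Rp} -> \sum_(a <- s) a != 0.
Proof.
have [n] := ubnP (size s); elim: n s => // n IH [//|a s] /=.
rewrite ltnS => size_s _ sR; have aR : a \in Rp by apply: sR; rewrite mem_head.
have ssR : {subset s <= Rp} by move=> b bs; apply: sR; rewrite inE bs orbT.
apply/negP => /eqP; rewrite big_cons => sum0.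
have [h [ah int_h neg_h _ _]] := coroot (pos_root aR).
have [b bs bneg] : exists2 b, b \in s & (b h : K) < 0.
  apply: contrapT => none.
  have sum_ge0 : 0 <= \sum_(b <- s) (b h : K).
    rewrite big_seq; apply: sumr_ge0 => b bs.
    have [z bz] := int_h b (pos_root (ssR b bs)).
    rewrite bz ler0z leNgt; apply/negP => z0; apply: none; exists b => //.
    by rewrite bz ltrz0.
  have : 0 < 2%:R + \sum_(b <- s) (b h : K) by rewrite ltr_wpDr // ltr0n.
  have -> : 2%:R + \sum_(b <- s) (b h : K) = ((a + \sum_(b <- s) b) h : K).
    by rewrite add_lfunE sum_lfunE ah.
  by rewrite sum0 zero_lfunE ltxx.
have bR := ssR b bs.
have [ab0|rab] := neg_h b (pos_root bR) bneg.
  by have := pos_rootN aR; rewrite (addr0_eq ab0) bR.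
have abR := pos_root_add aR bR rab.
have /negP[] : \sum_(c <- a + b :: rem b s) c != 0.
  apply: IH => //=; first by rewrite size_rem // prednK //; case: (s) bs.
  by move=> c; rewrite inE => /orP[/eqP->//|/mem_rem/ssR].
by rewrite big_cons -addrA -[X in a + X](big_rem b bs (P := xpredT)) sum0.
Qed.

(** Sums of arbitrary positive roots, rather than of simple ones, make irreflexivity a restatement
    of [sum_pos_roots_neq0]. *)
Definition root_lt (a b : dual T) : Prop :=
  exists s, [/\ s != [::], {subset s <= Rp} & b = a + \sum_(c <- s) c].

Lemma root_lt_irr a : ~ root_lt a a.
Proof.
move=> [s [s0 sR /eqP]]; rewrite -subr_eq0 opprD addrA subrr sub0r oppr_eq0.
exact/negP/sum_pos_roots_neq0.
Qed.

Lemma root_lt_trans a b c : root_lt a b -> root_lt b c -> root_lt a c.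
Proof.
move=> [s [s0 sR ->]] [u [u0 uR ->]]; exists (s ++ u); split.
- by case: (s) s0.
- by move=> d; rewrite mem_cat => /orP[/sR|/uR].
- by rewrite big_cat addrA.
Qed.

Lemma root_lt_add a b : b \in Rp -> root_lt a (a + b).
Proof.
move=> bR; exists [:: b]; split=> //; last by rewrite big_seq1.
by move=> c; rewrite inE => /eqP->.
Qed.

(** Induction on the number of positive roots below [a]. The order [r] is a parameter because both
    [root_lt] and its converse are used. *)
Lemma root_wf_ind (r : dual T -> dual T -> Prop) (P : dual T -> Prop) :
  (forall a, ~ r a a) -> (forall a b c, r a b -> r b c -> r a c) ->
  (forall a, a \in Rp -> (forall b, b \in Rp -> r b a -> P b) -> P a) ->
  forall a, a \in Rp -> P a.
Proof.
move=> irr tr step a; pose below a := [seq c <- Rp | `[< r c a >]].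
have [n] := ubnP (size (below a)); elim: n a => // n IH a.
rewrite ltnS => size_a aR; apply: step => // b bR rba; apply: IH => //.
apply: leq_trans size_a; apply: (@uniq_leq_size _ (b :: below b)).
  rewrite /= filter_uniq ?fset_uniq // andbT mem_filter negb_and.
  by apply/orP; left; apply/asboolP/irr.
move=> c; rewrite inE => /orP[/eqP->|]; rewrite !mem_filter.
  by rewrite bR andbT; apply/asboolP.
by move=> /andP[/asboolP rcb ->]; rewrite andbT; apply/asboolP/(tr _ b).
Qed.

Lemma simple_root_pos a : simple_root Rp a -> a \in Rp.
Proof. by move=> /andP[]. Qed.

(** A positive root [a] that is not simple splits as [(a - b) + b] with both terms positive and
    lower. *)
Lemma pos_root_simple_sum a : a \in Rp ->
  exists n : dual T -> nat, a = \sum_(c <- Rp | simple_root Rp c) c *+ n c.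
Proof.
move: a; apply: (root_wf_ind root_lt_irr root_lt_trans) => a aR IH.
have [sa|] := boolP (simple_root Rp a).
  exists (fun c => c == a); rewrite big_mkcond (bigD1_seq a) ?fset_uniq //=.
  rewrite sa eqxx mulr1n big1 ?addr0 // => c /negPf ->.
  by rewrite mulr0n; case: ifP.
rewrite /simple_root aR /= => /allPn[b bR]; rewrite negbK => abR.
have eqa : a = (a - b) + b by rewrite subrK.
have [|n1 E1] := IH b bR; first by rewrite eqa addrC; apply: root_lt_add.
have [|n2 E2] := IH _ abR; first by rewrite {2}eqa; apply: root_lt_add.
exists (fun c => (n2 c + n1 c)%N); rewrite eqa E2 E1 -big_split.
by apply: eq_bigr => c _; rewrite mulrnDr.
Qed.

Lemma sum_pos_roots_simple (s : seq (dual T)) : {subset s <= Rp} ->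
  exists n : dual T -> nat, \sum_(a <- s) a = \sum_(c <- Rp | simple_root Rp c) c *+ n c.
Proof.
elim: s => [|a s IH] sR.
  by exists (fun=> 0%N); rewrite big_nil big1 // => c _; rewrite mulr0n.
have [|n1 E1] := pos_root_simple_sum (a := a); first by apply: sR; rewrite mem_head.
have [b bs|n2 E2] := IH; first by apply: sR; rewrite inE bs orbT.
exists (fun c => (n1 c + n2 c)%N); rewrite big_cons E2 {1}E1 -big_split.
by apply: eq_bigr => c _; rewrite mulrnDr.
Qed.

Lemma simple_sum_pos_roots (n : dual T -> nat) :
  exists s : seq (dual T), {subset s <= Rp} /\
    \sum_(c <- Rp | simple_root Rp c) c *+ n c = \sum_(a <- s) a.
Proof.
exists (flatten [seq nseq (n c) c | c <- Rp & simple_root Rp c]); split.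
  move=> a /flattenP[_ /mapP[c + ->]] /nseqP[-> _].
  by rewrite mem_filter => /andP[].
rewrite big_flatten /= big_map big_filter; apply: eq_bigr => c _.
by rewrite big_nseq iter_addr_0.
Qed.

Definition root_le (a b : dual T) : Prop :=
  exists s, {subset s <= Rp} /\ b = a + \sum_(c <- s) c.

Lemma root_le_anti a b : root_le a b -> root_le b a -> a = b.
Proof.
move=> [s [sR sE]] [u [uR uE]].
have [s_nil|s0] := eqVneq s [::]; first by rewrite sE s_nil big_nil addr0.
case: (@root_lt_irr a); exists (s ++ u); split.
- by case: (s) s0.
- by move=> d; rewrite mem_cat => /orP[/sR|/uR].
- by rewrite big_cat addrA -sE.
Qed.

Lemma highest_rootP h :
  highest_root br Rp h <-> is_root h /\ forall b, is_root b -> root_le b h.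
Proof.
split=> -[rh le_h]; split=> // b rb.
  have [n nE] := le_h b rb; have [s [sR sE]] := simple_sum_pos_roots n.
  by exists s; split=> //; rewrite -sE -nE addrC subrK.
have [s [sR ->]] := le_h b rb; have [n nE] := sum_pos_roots_simple sR.
by exists n; rewrite addrC addKr.
Qed.

Lemma highest_root_unique h h' :
  highest_root br Rp h -> highest_root br Rp h' -> h = h'.
Proof.
move=> /highest_rootP[rh le_h] /highest_rootP[rh' le_h'].
by apply: root_le_anti; [apply: le_h'|apply: le_h].
Qed.

Lemma maximal_pos_root a : a \in Rp ->
  exists m, m \in Rp /\ forall b, b \in Rp -> m + b \notin Rp.
Proof.
move: a; apply: (root_wf_ind (r := fun a b => root_lt b a)).
- exact: root_lt_irr.
- by move=> a b c ba cb; apply: root_lt_trans cb ba.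
move=> a aR IH.
have [[b [bR abR]]|none] := pselect (exists b, b \in Rp /\ a + b \in Rp).
  by apply: (IH (a + b)) => //; apply: root_lt_add.
by exists a; split=> // b bR; apply/negP => abR; apply: none; exists b.
Qed.

(** * Root vectors and the structure of the Borel subalgebra *)

Lemma root_vector_neq0 a : a \in Rp -> X a != 0.
Proof. by move/rootX => []. Qed.

Lemma root_vector_weight a : a \in Rp -> wv a (X a).
Proof. by move/rootX => []. Qed.

Lemma root_vector_line a x : a \in Rp -> wv a x -> x \in <[X a]>%VS.
Proof.
move=> aR; apply: root_space_line (pos_root aR) (root_vector_weight aR) _.
exact: root_vector_neq0.
Qed.

Lemma br_root_vectors a b : a \in Rp -> b \in Rp ->
  br (X a) (X b) = 0 \/ a + b \in Rp.
Proof.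
move=> aR bR; have [->|nz] := eqVneq (br (X a) (X b)) 0; [by left|right].
have wab := weight_vector_br (root_vector_weight aR) (root_vector_weight bR).
have [ab0|] := weight_vector_root wab nz; last exact: pos_root_add.
by have := pos_rootN aR; rewrite (addr0_eq ab0) bR.
Qed.

Local Notation nplus := (\sum_(a <- Rp) <[X a]>)%VS.
Local Notation borelX := (borel Rp X).

Lemma root_vector_nil a : a \in Rp -> X a \in nplus.
Proof.
move=> aR; rewrite (big_rem a aR) /=; apply: (subvP (addvSl _ _)).
exact: memv_line.
Qed.

Lemma nil_sub U : (forall a, a \in Rp -> X a \in U) -> (nplus <= U)%VS.
Proof.
move=> XU; rewrite big_seq; elim/big_ind: _ => [|V W VU WU|a aR].
- exact: sub0v.
- by rewrite subv_add VU.
- by rewrite -memvE XU.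
Qed.

Lemma borel_sub U : (T <= U)%VS -> (forall a, a \in Rp -> X a \in U) -> (borelX <= U)%VS.
Proof. by move=> TU XU; rewrite subv_add TU nil_sub. Qed.

Lemma torus_borel s : s \in T -> s \in borelX.
Proof. by move=> sT; apply: (subvP (addvSl _ _)). Qed.

Lemma root_vector_borel a : a \in Rp -> X a \in borelX.
Proof. by move=> aR; apply: (subvP (addvSr _ _)); apply: root_vector_nil. Qed.

Lemma br_borel x y : x \in borelX -> y \in borelX -> br x y \in nplus.
Proof.
have [abT _ _] := cartanT.
have Tn s a : s \in T -> a \in Rp -> br s (X a) \in nplus.
  move=> sT aR; have [c ->] := weight_vector_torus (root_vector_weight aR) sT.
  by rewrite memvZ // root_vector_nil.
have brT s y' : s \in T -> y' \in borelX -> br s y' \in nplus.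
  move=> sT; rewrite -adE memv_preim; apply/subvP/borel_sub => [|a aR].
    by apply/subvP => u uT; rewrite -memv_preim adE abT ?mem0v.
  by rewrite -memv_preim adE Tn.
have brX a y' : a \in Rp -> y' \in borelX -> br (X a) y' \in nplus.
  move=> aR; rewrite -adE memv_preim; apply/subvP/borel_sub => [|b bR].
    by apply/subvP => u uT; rewrite -memv_preim adE brC memvN Tn.
  rewrite -memv_preim adE; have [->|abR] := br_root_vectors aR bR; first exact: mem0v.
  have := weight_vector_br (root_vector_weight aR) (root_vector_weight bR).
  by move/(root_vector_line abR) => /vlineP[c ->]; rewrite memvZ // root_vector_nil.
move=> + yg; rewrite brC memvN -adE memv_preim; apply/subvP/borel_sub => [|a aR].
  by apply/subvP => u uT; rewrite -memv_preim adE brC memvN brT.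
by rewrite -memv_preim adE brC memvN brX.
Qed.

Lemma nil_borel : (nplus <= borelX)%VS. Proof. exact: addvSr. Qed.

Lemma borel_lie_algebra : lie_algebra br borelX.
Proof.
case: ssL => [[_ lin alt jac] _]; split=> [x y xg yg|c x y z _ _ _|x _|x y z _ _ _].
- by apply: (subvP nil_borel); apply: br_borel.
- by apply: lin; apply: memvf.
- by apply: alt; apply: memvf.
- by apply: jac; apply: memvf.
Qed.

Lemma derived_borel : (derived br borelX <= nplus)%VS.
Proof. by apply: lie_prod_min => x y; apply: br_borel. Qed.

Lemma nil_components x : x \in nplus ->
  exists c : dual T -> K, x = \sum_(a <- Rp) c a *: X a.
Proof.
have : uniq Rp by apply: fset_uniq.
elim: (Rp : seq _) x => [|a s IH] x /=.
  by rewrite big_nil memv0 => _ /eqP->; exists (fun=> 0); rewrite big_nil.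
move=> /andP[as_ us]; rewrite big_cons => /memv_addP[_ /vlineP[k ->] [y /(IH y us)[c ->] ->]].
exists (fun b => if b == a then k else c b); rewrite big_cons eqxx; congr (_ + _).
by apply: eq_big_seq => b bs; case: eqP => // ba; rewrite -ba bs in as_.
Qed.

Lemma stable_borel_components U x : T_stable U -> x \in borelX -> x \in U ->
  exists t (c : dual T -> K),
    [/\ x = vsval t + \sum_(a <- Rp) c a *: X a, vsval t \in U &
        forall a, a \in Rp -> c a *: X a \in U].
Proof.
move=> stU /memv_addP[s sT [_ /nil_components[c ->] ->]] xU.
(* The torus part is filed under weight [0], so that [s] and the root components form one family of
   weight vectors. *)
pose y a := if a == 0 then s else if a \in Rp then c a *: X a else 0.
have R0 : 0 \notin Rp by apply/negP => /pos_root_neq0; rewrite eqxx.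
have yR a : a \in Rp -> y a = c a *: X a.
  by move=> aR; rewrite /y aR (negPf (pos_root_neq0 aR)).
have yU : forall a, a \in (0 :: Rp : seq (dual T)) -> y a \in U.
  apply: stable_weight_components => // [a||].
  - rewrite /y; case: eqP => [->|_]; first exact/weight_vector0P.
    case: ifP => [aR|_]; last exact: weight_vector0.
    exact/weight_vectorZ/root_vector_weight.
  - by rewrite /= R0 fset_uniq.
  - by rewrite big_cons {1}/y eqxx (eq_big_seq _ yR).
exists (vsproj T s), c; rewrite vsprojK //; split=> // [|a aR].
  by have := yU 0 (mem_head _ _); rewrite /y eqxx.
by rewrite -yR // yU // inE aR orbT.
Qed.

Lemma stable_nil_components U x : T_stable U -> x \in nplus -> x \in U ->
  exists c : dual T -> K,
    x = \sum_(a <- Rp) c a *: X a /\ forall a, a \in Rp -> c a *: X a \in U.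
Proof.
move=> stU /nil_components[c xE] xU; exists c; split=> // a aR.
pose y a := if a \in Rp then c a *: X a else 0.
have yR b : b \in Rp -> y b = c b *: X b by rewrite /y => ->.
rewrite -yR //; apply: stable_weight_components (fset_uniq _) _ _ aR => // [b|].
  rewrite /y; case: ifP => [bR|_]; last exact: weight_vector0.
  exact/weight_vectorZ/root_vector_weight.
by rewrite (eq_big_seq _ yR) -xE.
Qed.

(** * One-dimensional ideals of the Borel subalgebra and of its quotients *)

Lemma ideal_T_stable J : lie_ideal br borelX J -> T_stable J.
Proof. by move=> [_ idJ] s x sT; apply: idJ; apply: torus_borel. Qed.

(** If a vector of the line has a nonzero root component, the line is [<[X h]>], and [[X a, X h]],
    of weight [a + h] different from [h], must vanish. Otherwise the line lies in [T]. *)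
Lemma one_dim_ideal I : lie_ideal br borelX I -> \dim I = 1%N ->
  exists h, [/\ h \in Rp, I = <[X h]>%VS &
    forall a, a \in Rp -> br (X a) (X h) = 0].
Proof.
move=> idI dimI; have stI := ideal_T_stable idI; have [/subvP Ig brI] := idI.
have lineI v : v \in I -> v != 0 -> I = <[v]>%VS.
  move=> vI v0; apply/esym/eqP; rewrite eqEdim -memvE vI dimI dim_vline v0.
  by [].
have [v vI v0] : exists2 v, v \in I & v != 0.
  by exists (vpick I); rewrite ?memv_pick // vpick0 -dimv_eq0 dimI.
have [t [c [vE tI cI]]] := stable_borel_components stI (Ig _ vI) vI.
have [[h [hR hI]]|none] := pselect (exists h, h \in Rp /\ c h *: X h != 0).
  have XI : X h \in I.
    have c0 : c h != 0 by apply: contraNneq hI => ->; rewrite scale0r.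
    by rewrite -[X h](scalerK c0) memvZ // cI.
  have IE := lineI _ XI (root_vector_neq0 hR); exists h; split=> // a aR.
  have wah := weight_vector_br (root_vector_weight aR) (root_vector_weight hR).
  have : br (X a) (X h) \in I by rewrite brI ?root_vector_borel.
  rewrite IE => /vlineP[k kE]; apply/eqP/negP => /negP nz.
  case/negP: (pos_root_neq0 aR); apply/eqP/(addIr h); rewrite add0r.
  apply: weight_vector_unique nz wah _.
  by rewrite kE; apply/weight_vectorZ/root_vector_weight.
have tE : v = vsval t.
  rewrite vE big_seq big1 ?addr0 // => a aR; apply/eqP/negP => /negP nz.
  by apply: none; exists a.
have wt : wv 0 (vsval t) by apply/weight_vector0P/subvsP.
(* A line in [T] has weight 0, so it contains no nonzero bracket of weight [a]. Thus all roots
   vanish at [t], which makes [t] central. *)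
have t_pos0 a : a \in Rp -> (a t : K) = 0.
  move=> aR; have wa := root_vector_weight aR.
  have : br (X a) (vsval t) \in I by rewrite brI ?root_vector_borel.
  rewrite (lineI _ vI v0) -tE => /vlineP[k kE].
  have wX : wv (a + 0) (br (X a) v) by apply: weight_vector_br; rewrite // tE.
  have [z|nz] := eqVneq (br (X a) v) 0.
    move: z; rewrite tE brC wa => /eqP; rewrite oppr_eq0 scaler_eq0.
    by rewrite (negPf (root_vector_neq0 aR)) orbF => /eqP.
  case/eqP: (pos_root_neq0 aR); rewrite -[a]addr0.
  apply: weight_vector_unique nz wX _; rewrite kE tE.
  exact: weight_vectorZ.
case/eqP: v0; rewrite tE; apply: center0 => y.
have [ws [us ws0 wsP dec]] := stable_decomposition.
have [u [wu _ ->]] := dec fullv y (fun s x _ _ => memvf _) (memvf y).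
rewrite brC br_sumr big1 ?oppr0 // => a _; rewrite wu.
have [->|ua0] := eqVneq (u a) 0; first by rewrite scaler0.
have [->|/root_pos_or_neg[/t_pos0->|/t_pos0/eqP]] := weight_vector_root (wu a) ua0.
- by rewrite zero_lfunE scale0r.
- by rewrite scale0r.
- by rewrite dualN oppr_eq0 => /eqP->; rewrite scale0r.
Qed.

Lemma ideal_roots_in (J : {vspace L}) a x : x \in J -> x != 0 -> wv a x -> a \in Rp ->
  roots_in br Rp J a.
Proof.
move=> xJ x0 ax aR; split=> // y ay.
by have /vlineP[k ->] := root_space_line (pos_root aR) ax x0 ay; apply: memvZ.
Qed.

(** The preimage [U] of the line is [J] plus the line of [v]; being [T]-stable, it contains some
    [X a] outside [J]. *)
Lemma one_dim_quotient_ideal (J : {vspace L}) (I : {vspace quo J}) :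
  lie_ideal br borelX J -> lie_ideal (quo_br br J) (quo_pi J @: borelX)%VS I ->
  \dim I = 1%N -> (I <= quo_pi J @: nplus)%VS ->
  exists a, [/\ a \in Rp, X a \notin J, I = <[quo_pi J (X a)]>%VS &
    forall b, b \in Rp -> br (X b) (X a) = 0 \/ roots_in br Rp J (b + a)].
Proof.
move=> idJ idI dimI In; have stJ := ideal_T_stable idJ.
have quoE := quo_brE borel_lie_algebra idJ.
have lineI v : v \in I -> v != 0 -> I = <[v]>%VS.
  move=> vI v0; apply/esym/eqP; rewrite eqEdim -memvE vI dimI dim_vline v0.
  by [].
have [u uI u0] : exists2 u, u \in I & u != 0.
  by exists (vpick I); rewrite ?memv_pick // vpick0 -dimv_eq0 dimI.
have /memv_imgP[v vn uE] := subvP In _ uI; have vg := subvP nil_borel v vn.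
have vJ : v \notin J by rewrite -(quo_pi_eq0 J) -uE.
pose U := (quo_pi J @^-1: I)%VS.
have UP x : (x \in U) = (quo_pi J x \in I) by rewrite memv_preim.
have JU x : x \in J -> x \in U by rewrite UP -(quo_pi_eq0 J) => /eqP->; apply: mem0v.
have vU : v \in U by rewrite UP -uE.
have UE x : x \in U -> exists k, x - k *: v \in J.
  rewrite UP (lineI _ uI u0) => /vlineP[k kE]; exists k.
  by rewrite -(quo_pi_eq0 J) linearB linearZ /= kE uE subrr.
have brU x y : x \in borelX -> y \in borelX -> y \in U -> br x y \in U.
  move=> xg yg; rewrite !UP => yI; rewrite -quoE //; apply: (idI.2) => //.
  exact: memv_img.
have stU : T_stable U.
  move=> s x sT xU; have [k kJ] := UE x xU.
  rewrite -[x](subrK (k *: v)) brDr; apply: memvD; first exact/JU/stJ.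
  by rewrite brZr memvZ // brU // torus_borel.
have [c [vE cU]] := stable_nil_components stU vn vU.
have [a [aR aJ]] : exists a, a \in Rp /\ c a *: X a \notin J.
  apply: contrapT => none; case/negP: vJ; rewrite vE big_seq memv_suml // => a aR.
  by apply/negPn/negP => caJ; apply: none; exists a.
have ca0 : c a != 0 by apply: contraNneq aJ => ->; rewrite scale0r mem0v.
have XJ : X a \notin J by apply: contraNN aJ => XJ; apply: memvZ.
have XU : X a \in U by rewrite -[X a](scalerK ca0) memvZ // cU.
have IE : I = <[quo_pi J (X a)]>%VS.
  by apply: lineI; rewrite -?UP // quo_pi_eq0.
exists a; split=> // b bR.
have [->|bR_a] := br_root_vectors bR aR; first by left.
have [->|nz] := eqVneq (br (X b) (X a)) 0; first by left.
right; have wba := weight_vector_br (root_vector_weight bR) (root_vector_weight aR).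
apply: ideal_roots_in _ nz (wba) bR_a.
have : br (X b) (X a) \in U by rewrite brU ?root_vector_borel.
rewrite UP IE => /vlineP[k kE].
have neq : b + a != a by rewrite -subr_eq0 addrK pos_root_neq0.
(* The bracket is congruent to [k *: X a] modulo [J]. As [b + a] differs from [a], both components
   of the difference, recorded by [y], lie in [J]. *)
pose y d := if d == a then - k *: X a else
            if d == b + a then br (X b) (X a) else 0.
have := @stable_weight_components J [:: b + a; a] y stJ.
rewrite !big_cons big_nil addr0 /= /y eqxx (negPf neq) eqxx inE neq /=.
move=> comp; have := comp _ isT _ (b + a) (mem_head _ _).
rewrite (negPf neq) eqxx; apply=> [d|].
  case: eqP => [->|_]; first exact/weight_vectorZ/root_vector_weight.
  by case: eqP => [->//|_]; apply: weight_vector0.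
by rewrite -(quo_pi_eq0 J) linearD linearZ /= kE scaleNr subrr.
Qed.

(** * The highest root and the unique line ideal in the irreducible case *)

Lemma triangular_decomposition (Y : dual T -> L) U x :
  (forall a, a \in Rp -> wv (- a) (Y a) /\ Y a != 0) ->
  (T <= U)%VS -> (forall a, a \in Rp -> X a \in U) ->
  (forall a, a \in Rp -> Y a \in U) -> x \in U.
Proof.
move=> YP TU XU YU; have [ws [us ws0 wsP dec]] := stable_decomposition.
have [u [wu _ ->]] := dec fullv x (fun s x _ _ => memvf _) (memvf x).
rewrite memv_suml // => a _; have [->|ua0] := eqVneq (u a) 0; first exact: mem0v.
have [a0|ra] := weight_vector_root (wu a) ua0.
  by apply/(subvP TU)/weight_vector0P; rewrite -{1}a0.
have [aR|aR] := root_pos_or_neg ra.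
  by have /vlineP[k ->] := root_vector_line aR (wu a); rewrite memvZ ?XU.
have [wY Y0] := YP _ aR; rewrite opprK in wY.
by have /vlineP[k ->] := root_space_line ra wY Y0 (wu a); rewrite memvZ ?YU.
Qed.

(* The submodule generated by a vector killed by the positive root vectors is
   generated by the negative root vectors alone, hence has weights [<= h]. *)
Lemma highest_weight_ideal h : h \in Rp ->
  (forall a, a \in Rp -> br (X a) (X h) = 0) ->
  exists W, [/\ X h \in W, forall x y, y \in W -> br x y \in W &
    forall a x, x != 0 -> wv a x -> x \in W -> root_le a h].
Proof.
move=> hR Xh0.
have exY a : exists y, a \in Rp -> wv (- a) y /\ y != 0.
  have [aR|_] := boolP (a \in Rp); last by exists 0.
  by have [_ [y y0 wy]] := is_rootN (pos_root aR); exists y.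
have [Y YP] := boolp.choice exY.
have [ws [us ws0 wsP dec]] := stable_decomposition.
(* The weights below [h] cut out a subspace [U], in which the ideal is sought; the vectors [Y a]
   preserve [U] since they lower weights. *)
pose below x := exists y : dual T -> L, [/\ forall a, wv a (y a),
  forall a, y a != 0 -> root_le a h & x = \sum_(a <- ws) y a].
have [||U UP] := @vspace_of_pred K L below.
- exists (fun=> 0); split=> [a|a|]; rewrite ?eqxx ?big1 //; exact: weight_vector0.
- move=> c _ _ [y [wy yh ->]] [z [wz zh ->]].
  exists (fun a => c *: y a + z a); split=> [a|a|].
  + exact: weight_vectorP.
  + have [y0|/yh //] := eqVneq (y a) 0.
    by rewrite y0 scaler0 add0r; apply: zh.
  + by rewrite scaler_sumr -big_split.
have inU a z : wv a z -> (z != 0 -> root_le a h) -> z \in U.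
  move=> az ah; have [->|z0] := eqVneq z 0; first exact: mem0v.
  apply/UP; exists (fun b => if b == a then z else 0); split=> [b|b|].
  + by case: eqP => [->//|_]; apply: weight_vector0.
  + by case: (b =P a) => [->//|_]; rewrite eqxx.
  + rewrite -big_mkcond -big_filter filter_pred1_uniq ?big_seq1 //.
    exact: wsP az.
have YU a z : a \in Rp -> z \in U -> br (Y a) z \in U.
  move=> aR /UP[y [wy yh ->]]; rewrite br_sumr memv_suml // => b _.
  have [wY _] := YP a aR; apply: inU (weight_vector_br wY (wy b)) _ => nz.
  have [|s [sR hE]] := yh b; first by apply: contraNneq nz => ->; rewrite br0r.
  exists (a :: s); split; first by move=> d; rewrite inE => /orP[/eqP->|/sR].
  by rewrite hE big_cons addrACA addNr add0r.
(* Instead of generating a submodule, a maximal subspace of [U] with these stabilities is taken; the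
   line of [X h] is one of them. *)
pose stable W := [/\ X h \in W, T_stable W,
  forall a w, a \in Rp -> w \in W -> br (X a) w \in W & (W <= U)%VS].
have [|W [[XW stW RW WU] _ maxW]] := @vspace_maximal K L stable <[X h]>%VS.
  split; first exact: memv_line.
  - move=> s _ sT /vlineP[k ->].
    have [c cE] := weight_vector_torus (root_vector_weight hR) sT.
    by rewrite brZr cE scalerA; apply/vlineP; exists (k * c).
  - by move=> a _ aR /vlineP[k ->]; rewrite brZr Xh0 // scaler0 mem0v.
  - rewrite -memvE; apply: inU (root_vector_weight hR) _ => _.
    by exists [::]; split=> //; rewrite big_nil addr0.
(* [W'] adds one application of the negative root vectors. It contains [[L, W]], so it inherits the
   stabilities of [W] by the Jacobi identity, and maximality gives [W' = W]. *)
pose W' := (W + \sum_(a <- Rp) (ad (Y a) @: W))%VS.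
have WW' : (W <= W')%VS by apply: addvSl.
have YW' a w : a \in Rp -> w \in W -> br (Y a) w \in W'.
  move=> aR wW; apply: (subvP (addvSr _ _)); rewrite (big_rem a aR) /=.
  by apply: (subvP (addvSl _ _)); rewrite -adE memv_img.
have W'sub V : (W <= V)%VS ->
    (forall a w, a \in Rp -> w \in W -> br (Y a) w \in V) -> (W' <= V)%VS.
  move=> WV YV; rewrite subv_add WV /= big_seq; elim/big_ind: _ => [|A B AV BV|a aR].
  - exact: sub0v.
  - by rewrite subv_add AV.
  - by apply/subvP => _ /memv_imgP[w wW ->]; rewrite adE YV.
have LW' x w : w \in W -> br x w \in W'.
  move=> wW; rewrite brC memvN -adE memv_preim.
  apply: (triangular_decomposition _ YP) => [|a aR|a aR].
  - by apply/subvP => s sT; rewrite -memv_preim adE brC memvN (subvP WW') ?stW.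
  - by rewrite -memv_preim adE brC memvN (subvP WW') ?RW.
  - by rewrite -memv_preim adE brC memvN YW'.
have lift x : (forall w, w \in W -> br x w \in W) ->
    forall w, w \in W' -> br x w \in W'.
  move=> xW w; rewrite -adE memv_preim; apply/subvP/W'sub => [|a u aR uW].
    by apply/subvP => u uW; rewrite -memv_preim adE (subvP WW') ?xW.
  by rewrite -memv_preim adE br_jacobi memvD ?LW' ?YW' ?xW.
have W'E : W' = W.
  apply: maxW (WW'); split; first exact: (subvP WW').
  - by move=> s w sT; apply: lift => u; apply: stW.
  - by move=> a w aR; apply: lift => u; apply: RW.
  - by apply: W'sub => // a w aR wW; apply: YU aR (subvP WU _ wW).
exists W; split=> // [x y yW|a x x0 ax /(subvP WU)/UP[y [wy yh xE]]].
  by rewrite -W'E LW'.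
have aws := wsP a x x0 ax; apply: yh.
have eqs : \sum_(b <- ws) y b = \sum_(b <- ws) (if b == a then x else 0).
  by rewrite -xE -big_mkcond -big_filter filter_pred1_uniq ?big_seq1.
have -> // := weight_components_inj us wy _ eqs aws; first by rewrite eqxx.
by move=> b; case: eqP => [->//|_]; apply: weight_vector0.
Qed.

(** [A] collects the roots occurring in an ideal [W] that contains [X h]. The coroot of such a root
    lies in [W], so every root nonzero on it occurs in [W] too. Hence [A] is orthogonal to the other
    roots, and irreducibility leaves none of those. *)
Lemma irreducible_highest_root h : irreducible_roots br T -> h \in Rp ->
  (forall a, a \in Rp -> br (X a) (X h) = 0) -> highest_root br Rp h.
Proof.
move=> [_ irr] hR Xh0; have [W [XW idW leW]] := highest_weight_ideal hR Xh0.
pose A a := is_root a /\ exists x, [/\ wv a x, x != 0 & x \in W].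
apply/highest_rootP; split; first exact: pos_root.
suff allA b : is_root b -> A b.
  by move=> b /allA[_ [x [bx x0 xW]]]; apply: leW x0 bx xW.
move=> rb; apply: contrapT => nAb.
apply: (irr A (fun a => is_root a /\ ~ A a)).
- move=> a; split=> [ra|[[]|[]] //].
  by have [Aa|nAa] := pselect (A a); [left|right].
- exists h; split; first exact: pos_root.
  by exists (X h); split=> //; [exact: root_vector_weight|exact: root_vector_neq0].
- by exists b.
move=> a c [ra xa] [rc nAc]; have [t [_ _ _ orth inW]] := coroot ra.
apply: orth; have tW := inW W idW xa.
apply/eqP/negP => /negP ct0; apply: nAc; split=> //.
have [_ [y y0 cy]] := rc; exists y; split=> //.
by rewrite -[y](scalerK ct0) memvZ // -cy brC memvN idW.
Qed.

Lemma killed_root_line_ideal h : h \in Rp ->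
  (forall a, a \in Rp -> br (X a) (X h) = 0) -> lie_ideal br borelX <[X h]>%VS.
Proof.
move=> hR Xh0; split; first by rewrite -memvE root_vector_borel.
move=> x _ xg /vlineP[k ->]; rewrite brZr memvZ // brC memvN -adE memv_preim.
apply: (subvP _ _ xg); apply: borel_sub => [|a aR].
  apply/subvP => s sT; rewrite -memv_preim adE brC memvN.
  by have [c ->] := weight_vector_torus (root_vector_weight hR) sT; rewrite memvZ ?memv_line.
by rewrite -memv_preim adE brC Xh0 // oppr0 mem0v.
Qed.

(** A maximal positive root gives a line ideal; the root of any line ideal is a highest root, and
    highest roots are unique. *)
Lemma irreducible_unique_ideal : irreducible_roots br T ->
  exists h, unique (highest_root br Rp) h /\
    forall I, lie_ideal br borelX I /\ \dim I = 1%N <-> I = <[X h]>%VS.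
Proof.
move=> irr; have [[a ra] _] := irr.
have [b bR] : exists b, b \in Rp.
  by have [aR|aR] := root_pos_or_neg ra; [exists a|exists (- a)].
have [h [hR hmax]] := maximal_pos_root bR.
have Xh0 c : c \in Rp -> br (X c) (X h) = 0.
  move=> cR; have [//|chR] := br_root_vectors cR hR.
  by have := hmax c cR; rewrite addrC chR.
have hh := irreducible_highest_root irr hR Xh0.
exists h; split; first by split=> // h' hh'; apply: highest_root_unique.
move=> I; split=> [[idI dimI]|->].
  have [h' [h'R -> Xh'0]] := one_dim_ideal idI dimI.
  by rewrite (highest_root_unique hh (irreducible_highest_root irr h'R Xh'0)).
by rewrite dim_vline root_vector_neq0 //; split=> //; apply: killed_root_line_ideal.
Qed.

End PositiveSystem.
End Weights.

Theorem proposition2p1 (F : realType) (L : vectType F[i])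
    (br : L -> L -> L) (T : {vspace L}) (Rp : {fset dual T})
    (X : dual T -> L) (g : {vspace L}) :
  semisimple br ->
  cartan_subalgebra br T ->
  positive_system br Rp ->
  root_vectors br Rp X ->
  g = borel Rp X ->
  [/\ (forall I : {vspace L}, lie_ideal br g I -> \dim I = 1%N ->
         exists2 h : dual T, h \in Rp &
           I = <[X h]>%VS /\
           (forall a : dual T, simple_root Rp a -> br (X a) (X h) = 0)),
      (irreducible_roots br T ->
         exists h : dual T,
           unique (highest_root br Rp) h /\
           (forall I : {vspace L},
              lie_ideal br g I /\ \dim I = 1%N <-> I = <[X h]>%VS)) &
      (forall (d : nat) (J : {vspace L}),
         lie_ideal br g J -> \dim J = d ->
         (J <= derived br g)%VS -> J <> derived br g ->
         forall I : {vspace quo J},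
           lie_ideal (quo_br br J) (quo_pi J @: g)%VS I -> \dim I = 1%N ->
           (I <= quo_pi J @: derived br g)%VS ->
           exists2 a : dual T, a \in Rp &
             [/\ ~ roots_in br Rp J a,
                 I = <[quo_pi J (X a)]>%VS &
                 forall b : dual T, simple_root Rp b ->
                   br (X b) (X a) = 0 \/ roots_in br Rp J (b + a)])].
Proof.
move=> ssL cartanT posR rootX ->; split=> [I idI dimI|irr|_ J idJ _ _ _ I idI dimI IJ].
- have [h [hR IE Xh0]] := one_dim_ideal ssL cartanT posR rootX idI dimI.
  by exists h => //; split=> // a /simple_root_pos/Xh0.
- exact: irreducible_unique_ideal.
have In := subv_trans IJ (limgS (quo_pi J) (derived_borel ssL cartanT posR rootX)).
have [a [aR XJ IE Xa]] :=
  one_dim_quotient_ideal ssL cartanT posR rootX idJ idI dimI In.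
exists a => //; split=> // [[_ allJ]|b /simple_root_pos/Xa //].
by case/negP: XJ; apply/allJ; case: (rootX a aR).
Qed.
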